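(* Let $f\in L^2(\Omega)$, let $\alpha,\beta>0$ be constants, and let $u\in H_0^1(\Omega)$ be the weak solution of $-\alpha\Delta u+\beta u=f$ in $\Omega$, $u=0$ on $\partial\Omega$. Let $V_h$ be a virtual element space of order $k$ on the polytopal mesh $\mathcal T_h$ with interpolation operator $I_h$ (so $I_hu\in V_h$), and let $\widetilde J_h$ (with $\widetilde J_h|_K=\widetilde J_k^K$ for $K\in\mathcal T_h$) be an interpolation operator into macro finite element spaces which satisfies the polynomial preservation and norm equivalence conditions stated in the context. Let $u_h\in V_h$ be the solution of $$(\alpha\nabla_h\widetilde J_hu_h,\nabla_h\widetilde J_hv_h)+(\beta\widetilde J_hu_h,\widetilde J_hv_h)=(f,\widetilde J_hv_h)\qquad\forall v_h\in V_h,$$ and let $u_\pi$ be any function on $\Omega$ with $u_\pi|_K\in\mathbb P_k(K)$ for all $K\in\mathcal T_h$. Then $$\|u-u_h\|_{1,h}\le C\big(\|u-I_hu\|_{1,h}+\|u-u_\pi\|_{1,h}+G_h\big),$$ where $$G_h:=\sup_{v_h\in V_h\setminus\{0\}}\frac{1}{\|v_h\|_{1,h}}\sum_{K\in\mathcal T_h}\int_{\partial K}\alpha\frac{\partial u}{\partial\bm n_K}\,\widetilde J_hv_h\,\mathrm ds,$$ and $C>0$ depends only on $\alpha,\beta$ and the constants in the norm equivalence of $\widetilde J_k^K$ (in particular not on the mesh size, $u$, $u_h$ or $u_\pi$).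
   Context: $\Omega\subset\mathbb R^d$ ($d=2,3$) is a bounded polytopal domain and $\mathcal T_h$ is a finite mesh of $\Omega$ consisting of polygons ($d=2$) or polyhedra ($d=3$); $\bm n_K$ is the unit outward normal on $\partial K$. $k\ge1$ is an integer and $\mathbb P_k(K)$ is the space of polynomials of degree $\le k$ on $K$. $(\cdot,\cdot)$ is the $L^2(\Omega)$ inner product, $|\cdot|_{m,K}$ is the $H^m(K)$ seminorm, with $|\cdot|_{0,K}=\|\cdot\|_K$ the $L^2(K)$ norm, and $\|\cdot\|_{1,K}$ is the $H^1(K)$ norm. The broken norm is $\|v\|_{1,h}=\big(\sum_{K\in\mathcal T_h}\|v\|_{1,K}^2\big)^{1/2}$ and the broken gradient is $(\nabla_hv)|_K=\nabla(v|_K)$. For each $K\in\mathcal T_h$, $V_h(K)\subseteq H^1(K)$ is a finite-dimensional local virtual element space containing $\mathbb P_k(K)$; $V_h$ is a linear space of functions $v_h$ with $v_h|_K\in V_h(K)$ for every $K\in\mathcal T_h$ (conforming or nonconforming). For each $K$, $\widetilde W_h(\mathcal T_K)\subseteq H^1(K)$ is a macro finite element space (piecewise polynomials on a simplicial subdivision $\mathcal T_K$ of $K$), and $\widetilde J_k^K:V_h(K)\to\widetilde W_h(\mathcal T_K)$ is a linear operator (computable from the degrees of freedom of $V_h(K)$) such that (i) polynomial preservation: $\widetilde J_k^Kq=q$ for all $q\in\mathbb P_k(K)$; (ii) norm equivalence: there are constants $c_1,c_2>0$ independent of $K$ and of the mesh size such that $c_1|v_h|_{m,K}\le|\widetilde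 J_k^Kv_h|_{m,K}\le c_2|v_h|_{m,K}$ for all $v_h\in V_h(K)$ and $m=0,1$. The weak solution $u\in H_0^1(\Omega)$ satisfies $\alpha(\nabla u,\nabla v)+\beta(u,v)=(f,v)$ for all $v\in H_0^1(\Omega)$. Since $\Delta u\in L^2(\Omega)$, the boundary integral $\int_{\partial K}\alpha\frac{\partial u}{\partial\bm n_K}w\,\mathrm ds$ for $w\in H^1(K)$ is understood as the duality pairing, i.e. it equals $(\alpha\nabla u,\nabla w)_K+(\alpha\Delta u,w)_K$. *)

(* Defs.v *)
From HB Require Import structures.
From mathcomp Require Import all_boot all_order all_algebra.
From mathcomp Require Import all_classical all_reals all_analysis.
From mathcomp Require mpoly.
Set Implicit Arguments.
Unset Strict Implicit.
Unset Printing Implicit Defensive.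
Import Order.TTheory GRing.Theory Num.Theory.
Import numFieldNormedType.Exports.
Local Open Scope classical_set_scope.
Local Open Scope ring_scope.

(* The library has no Lebesgue measure on [R^n].  The type ['rV[T]_n] gets the
   sigma-algebra generated by the coordinates, as the library does for
   [n.-tuple T]; for [T := R] these are the Borel sets. *)
Definition rV_display : measure_display -> measure_display.
Proof. exact. Qed.

Section rV_measurable.
Context {disp : measure_display} {T : measurableType disp} (n : nat).

Let coord (i : 'I_n) (x : 'rV[T]_n) : T := x ord0 i.

Let rV_set0 : g_sigma_preimage coord set0.
Proof. exact: sigma_algebra0. Qed.

Let rV_setC A : g_sigma_preimage coord A -> g_sigma_preimage coord (~` A).
Proof. exact: sigma_algebraC. Qed.

Let rV_bigcup (F : (set 'rV[T]_n)^nat) : (forall i, g_sigma_preimage coord (F i)) ->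
  g_sigma_preimage coord (\bigcup_i (F i)).
Proof. exact: sigma_algebra_bigcup. Qed.

HB.instance Definition _ := @isMeasurable.Build (rV_display disp)
  'rV[T]_n (g_sigma_preimage coord) rV_set0 rV_setC rV_bigcup.

End rV_measurable.

Section rV_lebesgue.
Context {R : realType}.

Definition rV_cons n (p : measurableTypeR R * 'rV[R]_n) : 'rV[R]_n.+1 :=
  \row_i (if unlift ord0 i is Some j then p.2 ord0 j else p.1).

Definition rV_uncons n (x : 'rV[R]_n.+1) : measurableTypeR R * 'rV[R]_n :=
  (x ord0 ord0, \row_j x ord0 (lift ord0 j)).

Lemma rV_consK n : cancel (@rV_cons n) (@rV_uncons n).
Proof.
move=> [a y]; rewrite /rV_uncons /rV_cons; congr pair.
  by rewrite mxE unlift_none.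
by apply/rowP => j; rewrite !mxE liftK.
Qed.

Lemma measurable_coord n (i : 'I_n) :
  measurable_fun [set: 'rV[R]_n] (fun x => x ord0 i).
Proof.
move=> _ Y mY; rewrite setTI; apply: sub_sigma_algebra => /=.
rewrite -bigcup_seq/=; exists i => /=; first by rewrite mem_index_enum.
by exists Y => //; rewrite setTI.
Qed.

Lemma measurable_fun_rVP (disp : measure_display) (T : measurableType disp) n
    (f : T -> 'rV[R]_n) :
  (forall i, measurable_fun [set: T] (fun x => f x ord0 i)) ->
  measurable_fun [set: T] f.
Proof.
move=> mf.
have sub : g_sigma_preimage (fun i x => f x ord0 i) `<=` measurable.
  apply: smallest_sub; first exact: sigma_algebra_measurable.
  case: n => [|n] in f mf *; first by rewrite big_ord0.
  by rewrite -bigcup_mkord_ord => A [i lt_in [B mB <-]]; exact: mf.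
move=> _ A mA; apply: sub.
have := g_sigma_preimage_comp (fun i (x : 'rV[R]_n) => x ord0 i) f.
by rewrite /comp => ->; exists A.
Qed.

Lemma measurable_rV_cons n : measurable_fun [set: _] (@rV_cons n).
Proof.
apply: measurable_fun_rVP => i; case: (unliftP ord0 i) => [j|] ->.
  rewrite (_ : (fun _ => _) = (fun x : 'rV[R]_n => x ord0 j) \o snd).
    by apply: measurableT_comp => //; exact: measurable_coord.
  by apply/funext => p; rewrite mxE liftK.
rewrite (_ : (fun _ => _) = fst); first exact: measurable_fst.
by apply/funext => p; rewrite mxE unlift_none.
Qed.

Lemma measurable_rV_uncons n : measurable_fun [set: _] (@rV_uncons n).
Proof.
apply/measurable_fun_pairP; split => /=; first exact: measurable_coord.
apply: measurable_fun_rVP => j.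
rewrite (_ : (fun _ => _) = fun x : 'rV[R]_n.+1 => x ord0 (lift ord0 j)).
  exact: measurable_coord.
by apply/funext => x; rewrite /= mxE.
Qed.

Section rV_cons_measure.
Variables (n : nat) (mu : {sigma_finite_measure set 'rV[R]_n -> \bar R}).

Definition rV_cons_measure : set 'rV[R]_n.+1 -> \bar R :=
  pushforward (@lebesgue_measure R \x mu)%E (@rV_cons n).

HB.instance Definition _ := Measure.copy rV_cons_measure
  (measure_function_pushforward__canonical__measure_function_Measure
    (@lebesgue_measure R \x mu)%E (@measurable_rV_cons n)).

Let sigma_finite_rV_cons : sigma_finite setT rV_cons_measure.
Proof.
have /sigma_finiteP[F [TF ndF Foo]] := sigma_finiteT (@lebesgue_measure R).
have /sigma_finiteP[G [TG ndG Goo]] := sigma_finiteT mu.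
exists (fun k => @rV_uncons n @^-1` (F k `*` G k)).
  rewrite -preimage_bigcup; apply/esym; rewrite -subTset => x _.
  have : setT (rV_uncons x).1 by [].
  have : setT (rV_uncons x).2 by [].
  rewrite {1}TG {1}TF => -[l _ Gl] [k _ Fk]; exists (maxn k l) => //; split.
  - by move: Fk; exact/subsetPset/ndF/leq_maxl.
  - by move: Gl; exact/subsetPset/ndG/leq_maxr.
move=> k; have [mF Fk] := Foo k; have [mG Gk] := Goo k; split.
  rewrite -[X in measurable X]setTI; apply: measurable_rV_uncons => //.
  exact: measurableX.
rewrite /rV_cons_measure /pushforward -comp_preimage.
rewrite (_ : _ \o _ = id); last by apply/funext => p; exact: rV_consK.
by rewrite preimage_id product_measure1E// lte_mul_pinfty// ge0_fin_numE.
Qed.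

HB.instance Definition _ := Measure_isSigmaFinite.Build _ _ _
  rV_cons_measure sigma_finite_rV_cons.

End rV_cons_measure.

(* [n]-fold product of the one-dimensional Lebesgue measure *)
Fixpoint rV_lebesgue n : {sigma_finite_measure set 'rV[R]_n -> \bar R} :=
  if n is m.+1 then rV_cons_measure (rV_lebesgue m) else \d_(0 : 'rV[R]_0).

End rV_lebesgue.
Arguments rV_lebesgue R n : clear implicits.

Section function_spaces.
Context {R : realType} {d : nat}.
Local Notation U := 'rV[R]_d.
Local Notation mu := (rV_lebesgue R d).
Implicit Types (D : set U) (u v w f : U -> R).

(* A function on [D] is represented either by any function on [R^d], of which
   only the values on [D] matter, or (when a set of functions on [D] is meant,
   as for local spaces) by its extension by zero [restr0 D v]. *)
Definition restr0 D v : U -> R := patch (fun=> 0) D v.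
Definition fun_on D : set (U -> R) := [set v : U -> R | forall x, ~ D x -> v x = 0].

Definition L2 D : set (U -> R) :=
  [set v : U -> R | measurable_fun D v /\ mu.-integrable D (fun x => (v x ^+ 2)%:E)].

Definition inner D v w : R := \int[mu]_(x in D) (v x * w x).
Definition inner_vec D (F G : U -> U) : R :=
  \int[mu]_(x in D) \sum_i F x ord0 i * G x ord0 i.

Definition partial (i : 'I_d) v : U -> R := fun x => 'D_(delta_mx ord0 i) v x.

Definition smooth v : Prop :=
  forall (s : seq 'I_d) (x : U), differentiable (foldr partial v s) x.

Definition test_fun D : set (U -> R) :=
  [set phi : U -> R | [/\ smooth phi, compact (closure [set x | phi x != 0])
            & closure [set x | phi x != 0] `<=` D]].

Definition is_wgrad D v (g : U -> U) : Prop :=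
  (forall i, L2 D (fun x => g x ord0 i)) /\
  forall phi i, test_fun D phi ->
    inner D v (partial i phi) = - inner D (fun x => g x ord0 i) phi.

Definition H1 D : set (U -> R) :=
  [set v : U -> R | L2 D v /\ exists g, is_wgrad D v g].

(* meaningful on [H1 D], where it is unique up to a null set *)
Definition wgrad D v : U -> U := xget (fun=> 0) [set g : U -> U | is_wgrad D v g].

(* distributional Laplacian in [L2 D]; meaningful when there is one *)
Definition wlap D v : U -> R :=
  xget (fun=> 0) [set g : U -> R | L2 D g /\ forall phi, test_fun D phi ->
    inner D v (fun x => \sum_i partial i (partial i phi) x) = inner D g phi].

Definition normL2 D v : R := Num.sqrt (inner D v v).
Definition seminormH1 D v : R :=
  Num.sqrt (inner_vec D (wgrad D v) (wgrad D v)).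
Definition normH1 D v : R :=
  Num.sqrt (normL2 D v ^+ 2 + seminormH1 D v ^+ 2).

Definition H10 D : set (U -> R) :=
  [set v : U -> R | H1 D v /\ forall e : R, 0 < e ->
    exists2 phi, test_fun D phi & normH1 D (fun x => v x - phi x) < e].

Definition weak_solution D (alpha beta : R) f u : Prop :=
  H10 D u /\ forall v, H10 D v ->
    alpha * inner_vec D (wgrad D u) (wgrad D v) + beta * inner D u v
    = inner D f v.

(* the integral of [alpha * du/dn * w] over the boundary of [D], as a duality
   pairing *)
Definition normal_flux D (alpha : R) u w : R :=
  inner_vec D (fun x => alpha *: wgrad D u x) (wgrad D w) +
  inner D (fun x => alpha * wlap D u x) w.

Definition subspace (V : set (U -> R)) : Prop :=
  V (fun=> 0) /\
  forall (a : R) v w, V v -> V w -> V (fun x => a * v x + w x).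

Definition finite_dim (V : set (U -> R)) : Prop :=
  exists (n : nat) (b : 'I_n -> U -> R), forall v, V v ->
    exists c : 'I_n -> R, v = (fun x => \sum_i c i * b i x).

Definition Pk (k : nat) D : set (U -> R) :=
  [set v : U -> R | exists p : mpoly.mpoly d R, all (fun m => (mpoly.mdeg m <= k)%N) (mpoly.msupp p) /\
    v = restr0 D (fun x => mpoly.meval (x ord0) p)].

End function_spaces.

Section meshes.
Context {R : realType} {d : nat}.
Local Notation U := 'rV[R]_d.

(* The rows of [S] are the vertices of the simplex. *)
Definition affine_indep (S : 'M[R]_(d.+1, d)) : bool :=
  (row_mx (const_mx 1 : 'M[R]_(d.+1, 1)) S : 'M[R]_(d.+1)) \in unitmx.

Definition face (S : 'M[R]_(d.+1, d)) (A : set 'I_d.+1) : set U :=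
  [set x | exists l : 'rV[R]_d.+1,
    [/\ forall i, 0 <= l ord0 i, forall i, ~ A i -> l ord0 i = 0,
        \sum_i l ord0 i = 1 & x = l *m S]].

Definition simplex (S : 'M[R]_(d.+1, d)) : set U := face S setT.

Definition covers (T : seq 'M[R]_(d.+1, d)) (D : set U) : Prop :=
  all affine_indep T /\
  closure D = [set x | exists2 S, S \in T & simplex S x].

Definition polytopal (D : set U) : Prop :=
  [/\ open D, D !=set0, connected D, bounded_set D & interior (closure D) = D]
  /\ exists T, covers T D.

(* simplices meet along common faces *)
Definition simplicial_subdivision (T : seq 'M[R]_(d.+1, d)) (D : set U) : Prop :=
  covers T D /\
  forall S S', S \in T -> S' \in T ->
    simplex S `&` simplex S' = face S [set i | exists j, row i S = row j S'].

Definition is_mesh (I : finType) (Omega : set U) (K : I -> set U) : Prop :=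
  [/\ forall i, polytopal (K i), forall i, K i `<=` Omega,
      trivIset setT K & closure Omega = \bigcup_i closure (K i)].

Definition local_vem_space (k : nat) (K : set U) (V : set (U -> R)) : Prop :=
  [/\ V `<=` fun_on K, V `<=` H1 K, subspace V, finite_dim V
    & Pk k K `<=` V].

Definition macro_space (K : set U) (T : seq 'M[R]_(d.+1, d))
    (W : set (U -> R)) : Prop :=
  [/\ W `<=` fun_on K, W `<=` H1 K, subspace W
    & exists r : nat, forall w S, W w -> S \in T ->
        Pk r (interior (simplex S)) (restr0 (interior (simplex S)) w)].

Definition macro_interpolation (k : nat) (c1 c2 : R) (K : set U)
    (V W : set (U -> R)) (J : (U -> R) -> (U -> R)) : Prop :=
  [/\ forall v, V v -> W (J v),
      forall (a : R) v w, V v -> V w ->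
        J (fun x => a * v x + w x) = (fun x => a * J v x + J w x),
      forall q, Pk k K q -> J q = q
    & forall v, V v ->
        c1 * normL2 K v <= normL2 K (J v) <= c2 * normL2 K v /\
        c1 * seminormH1 K v <= seminormH1 K (J v) <= c2 * seminormH1 K v].

Section broken.
Context {I : finType} (K : I -> set U).

(* The cells are disjoint, so at most one summand is not zero. *)
Definition glue (w : I -> U -> R) : U -> R :=
  fun x => \sum_i restr0 (K i) (w i) x.

Definition broken_grad (v : U -> R) : U -> U :=
  fun x => \row_j glue (fun i y => wgrad (K i) v y ord0 j) x.

Definition broken_norm (v : U -> R) : R :=
  Num.sqrt (\sum_i normH1 (K i) v ^+ 2).

Definition global_vem_space (V : I -> set (U -> R)) (Vh : set (U -> R)) : Prop :=
  subspace Vh /\ forall v i, Vh v -> V i (restr0 (K i) v).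

Definition global_interp (J : I -> (U -> R) -> (U -> R)) (v : U -> R) : U -> R :=
  glue (fun i => J i (restr0 (K i) v)).

Definition discrete_solution (Omega : set U) (alpha beta : R) (f : U -> R)
    (Vh : set (U -> R)) (Jh : (U -> R) -> (U -> R)) (uh : U -> R) : Prop :=
  Vh uh /\ forall vh, Vh vh ->
    inner_vec Omega (fun x => alpha *: broken_grad (Jh uh) x)
      (broken_grad (Jh vh)) +
    inner Omega (fun x => beta * Jh uh x) (Jh vh)
    = inner Omega f (Jh vh).

(* [sup] is 0 on the empty set, which is the case [Vh = {0}]. *)
Definition consistency_error (Omega : set U) (alpha : R) (u : U -> R)
    (Vh : set (U -> R)) (Jh : (U -> R) -> (U -> R)) : R :=
  sup [set r | exists vh, [/\ Vh vh,
    ~ ae_eq (rV_lebesgue R d) Omega vh (cst 0)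
    & r = (\sum_i normal_flux (K i) alpha u (Jh vh)) / broken_norm vh]].

End broken.
End meshes.

(* Main.v *)
Require Import Defs.
From mathcomp Require Import all_boot all_order all_algebra.
From mathcomp Require Import all_classical all_reals all_analysis.
From mathcomp Require Import measurable_realfun ring lra.
Import Order.TTheory GRing.Theory Num.Theory.
Import numFieldNormedType.Exports.
Local Open Scope classical_set_scope.
Local Open Scope ring_scope.
Set Implicit Arguments.
Unset Strict Implicit.
Unset Printing Implicit Defensive.

(** A Strang-type argument.  Let [a_h] be the broken energy form and
    [e = uh - Ih u].  On each cell, testing the weak equation with smooth
    compactly supported functions shows that the distributional Laplacian of
    [u] is [(beta u - f) / alpha]; hence the boundary terms add up to
    [a_h (u, Jh v) - (f, Jh v)], and the discrete equation gives
    [a_h (Jh e, Jh e) = a_h (Jh (upi - Ih u), Jh e) + a_h (u - upi, Jh e) - flux e],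
    because [Jh upi = upi] on every cell.  Coercivity, the Cauchy-Schwarz
    inequality and the norm equivalence conclude.

    All integrands over [Omega] carry a factor vanishing outside the cells, so
    the skeleton of the mesh need not be a null set.  Since [wgrad] and [wlap]
    are chosen arbitrarily among the weak derivatives, linearity rests on
    their uniqueness, i.e. on the fundamental lemma of the calculus of
    variations, for which smooth bumps [exp (- c / w)] are built on boxes;
    test functions are themselves admissible in the weak equation by
    integration by parts (Fubini along a coordinate axis). *)

(** * Borel sets and boxes *)

(** The consistency term is a real [sup], a true least upper bound only for a nonempty set bounded
    above, and its quotients carry no absolute value. Hence the flux is first bounded by a multiple
    of the broken norm whose factor depends on [u] and [f]; this only makes the supremum genuine and
    never enters the final constant. Symmetry under [v |-> -v] then turns the one-sided supremum
    into a bound of the absolute value. Functions that vanish almost everywhere are left out of the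
    supremum, but their broken norm is zero, and so is their flux. As [upi] need not belong to [Vh],
    the identities for [Jh] are proved on all functions that are cellwise virtual element functions,
    with no condition across faces. Origin of the constant: coercivity and the lower norm
    equivalence put [Num.min alpha beta * c1 ^+ 2] in front of the norm of [e]; each passage from
    [Jh v] back to [v] costs one factor [c2]; the triangle inequality adds 1. *)

Definition obox (R : realType) n (a b : 'rV[R]_n) : set 'rV[R]_n :=
  [set x | forall i, a ord0 i < x ord0 i < b ord0 i].

Definition cbox (R : realType) n (a b : 'rV[R]_n) : set 'rV[R]_n :=
  [set x | forall i, a ord0 i <= x ord0 i <= b ord0 i].

Section borel.
Context {R : realType} {n : nat}.
Implicit Types (A : set 'rV[R]_n) (a b x : 'rV[R]_n).

Lemma obox_cbox a b : obox a b `<=` cbox a b.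
Proof. by move=> x abx i; have /andP[/ltW -> /ltW ->] := abx i. Qed.

(** Makes the open boxes a pi-system, as the Dynkin argument of [integral_obox_all_eq0] requires. *)
Lemma oboxI a b c e : obox a b `&` obox c e =
  obox (\row_i Num.max (a ord0 i) (c ord0 i)) (\row_i Num.min (b ord0 i) (e ord0 i)).
Proof.
apply/seteqP; split => [x [abx cex] i|x abx].
  rewrite !mxE gt_max lt_min.
  by have /andP[-> ->] := abx i; have /andP[-> ->] := cex i.
by split=> i; have := abx i; rewrite !mxE gt_max lt_min => /andP[/andP[? ?] /andP[? ?]];
  apply/andP.
Qed.

Lemma measurable_preimage_coord i (Y : set R) : measurable Y ->
  measurable ((fun x : 'rV[R]_n => x ord0 i) @^-1` Y).
Proof. by move=> mY; rewrite -[X in measurable X]setTI; exact: measurable_coord. Qed.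

Lemma measurable_obox a b : measurable (obox a b).
Proof.
rewrite (_ : obox a b = \bigcap_(i in [set: 'I_n])
    ((fun x : 'rV[R]_n => x ord0 i) @^-1` `]a ord0 i, b ord0 i[%classic)).
  apply: fin_bigcap_measurable => // i _; exact: measurable_preimage_coord.
apply/seteqP; split => x abx i; last by have := abx i I; rewrite /= in_itv.
by move=> _ /=; rewrite in_itv /=; exact: abx.
Qed.

Lemma measurable_cbox a b : measurable (cbox a b).
Proof.
rewrite (_ : cbox a b = \bigcap_(i in [set: 'I_n])
    ((fun x : 'rV[R]_n => x ord0 i) @^-1` `[a ord0 i, b ord0 i]%classic)).
  apply: fin_bigcap_measurable => // i _; exact: measurable_preimage_coord.
apply/seteqP; split => x abx i; last by have := abx i I; rewrite /= in_itv.
by move=> _ /=; rewrite in_itv /=; exact: abx.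
Qed.

(** Rational corners leave only countably many boxes. The closed box stays inside [A] so that a bump
    supported on it is a test function on [A]. *)
Lemma nbhs_obox A x : nbhs x A -> exists p : 'rV[rat]_n * 'rV[rat]_n,
  obox (map_mx ratr p.1) (map_mx ratr p.2) x /\
  cbox (map_mx ratr p.1) (map_mx ratr p.2) `<=` A.
Proof.
move=> /nbhs_ballP[e /= e0 xeA].
have lo i : exists q : rat, x ord0 i - e < ratr q < x ord0 i.
  have [q] := @rat_in_itvoo R (x ord0 i - e) (x ord0 i) ltac:(by rewrite ltrBlDr ltrDl).
  by rewrite in_itv /= => ?; exists q.
have hi i : exists q : rat, x ord0 i < ratr q < x ord0 i + e.
  have [q] := @rat_in_itvoo R (x ord0 i) (x ord0 i + e) ltac:(by rewrite ltrDl).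
  by rewrite in_itv /= => ?; exists q.
have [p pP] := choice lo; have [q qP] := choice hi.
exists (\row_i p i, \row_i q i); split => [i|y py].
  by rewrite !mxE; have /andP[_ ->] := pP i; have /andP[-> _] := qP i.
apply: xeA; split => // i j; rewrite ord1.
have := py j; rewrite !mxE => /andP[py1 qy].
have /andP[p1 p2] := pP j; have /andP[q1 q2] := qP j.
rewrite /ball /= ltr_norml; apply/andP; split; lra.
Qed.

Lemma open_obox_cover A : open A -> exists (P : set nat) (a b : nat -> 'rV[R]_n),
  (forall k, P k -> cbox (a k) (b k) `<=` A) /\ A = \bigcup_(k in P) obox (a k) (b k).
Proof.
(* The default [(0, 0)] for codes of no pair is harmless: only indices whose closed box lies in [A]
   are kept. *)
move=> oA; pose pr k := odflt (0, 0) (@unpickle ('rV[rat]_n * 'rV[rat]_n)%type k).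
pose a k : 'rV[R]_n := map_mx ratr (pr k).1; pose b k : 'rV[R]_n := map_mx ratr (pr k).2.
exists [set k | cbox (a k) (b k) `<=` A], a, b; split => //.
apply/seteqP; split => [x Ax|x [k /= kA kx]]; last exact/kA/obox_cbox.
have [p [px pA]] := nbhs_obox (open_nbhs_nbhs (conj oA Ax)).
by exists (pickle p); rewrite /= /a /b /pr pickleK.
Qed.

Lemma open_rV_measurable A : open A -> measurable A.
Proof.
move=> /open_obox_cover[P [a [b [_ ->]]]].
by apply: bigcup_measurable => k _; exact: measurable_obox.
Qed.

Lemma continuous_rV_measurable (f : 'rV[R]_n -> R) :
  continuous f -> measurable_fun setT f.
Proof.
move=> cf; apply: (measurability _ (RGenOpens.measurableE R)).
move=> _ [_ [a [b ->] <-]]; rewrite setTI.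
by apply: open_rV_measurable; apply: open_comp => //; exact: interval_open.
Qed.

(** Replaces the coordinate generators by a family stable under intersection. A coordinate preimage
    of an open interval is open, hence a countable union of boxes. *)
Lemma rV_measurableE : @measurable _ 'rV[R]_n =
  <<s [set A | exists a b, A = obox a b] >>.
Proof.
apply/seteqP; split; last first.
  apply: smallest_sub; first exact: sigma_algebra_measurable.
  by move=> _ [a [b ->]]; exact: measurable_obox.
have oB A : open A -> <<s [set A | exists a b, A = @obox R n a b] >> A.
  move=> /open_obox_cover[P [a [b [_ ->]]]].
  rewrite bigcup_mkcond; apply: sigma_algebra_bigcup => k.
  case: ifPn => _; last exact: sigma_algebra0.
  by apply: sub_sigma_algebra; exists (a k), (b k).
apply: smallest_sub; first exact: smallest_sigma_algebra.
move=> A; rewrite -bigcup_seq /= => -[i _ [Y mY <-]]; rewrite setTI.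

have : <<s @RGenOpens.G R >> Y.
  by rewrite -[X in X Y](RGenOpens.measurableE R).
move: Y {mY}; apply: smallest_sub => [|_ [x [y ->]]].
  split=> [|B sB|F sF].
  - by rewrite preimage_set0; exact: sigma_algebra0.
  - by rewrite setTD preimage_setC; exact: sigma_algebraC.
  - by rewrite preimage_bigcup; exact: sigma_algebra_bigcup.
apply: oB; apply: open_comp; last exact: interval_open.
by move=> ? _; exact: coord_continuous.
Qed.
End borel.

Lemma rV_lebesgue_cbox_fin (R : realType) n (M : R) : 0 <= M ->
  (rV_lebesgue R n (cbox (const_mx (- M)%R) (const_mx M)) < +oo)%E.
Proof.
move=> M0; elim: n => [|n IHn] /=.
  by rewrite diracE; case: (_ \in _); rewrite ltry.
rewrite /rV_cons_measure /pushforward.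
rewrite (_ : _ @^-1` _ = `[- M, M]%classic `*` cbox (const_mx (- M)) (const_mx M)).
  rewrite product_measure1E //; last exact: measurable_cbox.
  have MM : (lebesgue_measure [set` `[- M, M]%R] < +oo)%E.
    by rewrite lebesgue_measure_itv /=; case: ifPn => // _; rewrite ltry.
  by apply: lte_mul_pinfty => //; rewrite ge0_fin_numE.
apply/seteqP; split => [[t y] /= ty|[t y] /= [tM yM] i].
  split=> [|j /=].
    by have := ty ord0; rewrite !mxE unlift_none /= in_itv.
  by have := ty (lift ord0 j); rewrite !mxE liftK.
rewrite !mxE; case: (unliftP ord0 i) => [j _|_].
  by have := yM j; rewrite !mxE.
by move: tM; rewrite in_itv.
Qed.

Lemma bounded_set_cbox (R : realType) n (D : set 'rV[R]_n) : bounded_set D ->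
  exists2 M : R, 0 < M & D `<=` cbox (const_mx (- M)) (const_mx M).
Proof.
move=> [M [Mr MD]]; exists (Num.max M 0 + 1); first by rewrite ltr_wpDl// le_max lexx orbT.
move=> x Dx i; have := MD (Num.max M 0 + 1) _ x Dx.
rewrite !mxE -ler_norml => H; apply: le_trans (H _); last first.
  by rewrite (@le_lt_trans _ _ (Num.max M 0))// ?le_max ?lexx// ltrDl.
rewrite -[leRHS]/(mx_norm x) mx_normrE.
exact: (le_bigmax _ (fun ij => `|x ij.1 ij.2|) (ord0, i)).
Qed.

Lemma bounded_rV_lebesgue_fin (R : realType) n (D : set 'rV[R]_n) : measurable D ->
  bounded_set D -> (rV_lebesgue R n D < +oo)%E.
Proof.
move=> mD /bounded_set_cbox[M M0 DM].
apply: le_lt_trans (rV_lebesgue_cbox_fin n (ltW M0)).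
by apply: le_measure; rewrite ?inE//; exact: measurable_cbox.
Qed.

(** * Square integrable functions *)

Section L2.
Context {R : realType} {d : nat}.
Local Notation U := 'rV[R]_d.
Local Notation mu := (rV_lebesgue R d).
Implicit Types (D : set U) (u v w z : U -> R) (F G H : U -> U).

Lemma inner_ext D v v' w w' : (forall x, D x -> v x = v' x) ->
  (forall x, D x -> w x = w' x) -> inner D v w = inner D v' w'.
Proof. by move=> vv ww; apply: eq_Rintegral => x /set_mem Dx; rewrite vv ?ww. Qed.

Lemma innerC D v w : inner D v w = inner D w v.
Proof. by apply: eq_Rintegral => x _; rewrite mulrC. Qed.

Lemma inner_ge0 D v : 0 <= inner D v v.
Proof. by apply: Rintegral_ge0 => x _; rewrite -expr2 sqr_ge0. Qed.

Lemma L2_0 D : L2 D (fun=> 0).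
Proof.
split; first exact: measurable_cst.
by rewrite (_ : (fun=> _) = cst 0%E); [exact: integrable0|rewrite expr0n].
Qed.

Lemma L2_subset D D' v : measurable D -> measurable D' -> D' `<=` D ->
  L2 D v -> L2 D' v.
Proof.
by move=> mD mD' DD [mv iv]; split; [exact: measurable_funS mv|exact: integrableS iv].
Qed.

Section measurable_domain.
Variables (D : set U) (mD : measurable D).

Lemma L2_ext v w : (forall x, D x -> v x = w x) -> L2 D v -> L2 D w.
Proof.
move=> vw [mv iv]; split.
  by apply: eq_measurable_fun mv => x /set_mem; exact: vw.
by apply: (eq_integrable mD) iv => x /set_mem /vw ->.
Qed.

Lemma L2_mul_integrable v w : L2 D v -> L2 D w ->
  mu.-integrable D (fun x => (v x * w x)%:E).
Proof.
move=> [mv iv] [mw iw].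
apply: (le_integrable mD _ _ (integrableD mD iv iw)).
  by apply/measurable_EFinP; exact: measurable_funM.
move=> x _ /=; rewrite lee_fin [leRHS]ger0_norm ?addr_ge0 ?sqr_ge0//.
rewrite normrM -(real_normK (num_real (v x))) -(real_normK (num_real (w x))).
by have := sqr_ge0 (`|v x| - `|w x|); have := sqr_ge0 (`|v x| + `|w x|); nra.
Qed.

Lemma L2_lin (a : R) v w : L2 D v -> L2 D w -> L2 D (fun x => a * v x + w x).
Proof.
move=> [mv iv] [mw iw]; split.
  by apply: measurable_funD => //; apply: measurable_funM.
apply: (le_integrable mD _ _ (integrableD mD
  (integrableZl mD (2 * a ^+ 2) iv) (integrableZl mD 2 iw))).
  apply/measurable_EFinP; apply: measurable_funX.
  by apply: measurable_funD => //; apply: measurable_funM.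
move=> x _ /=; rewrite lee_fin [leLHS]ger0_norm ?sqr_ge0// (le_trans _ (ler_norm _))//.
by have := sqr_ge0 (a * v x - w x); nra.
Qed.

Lemma L2_scale (a : R) v : L2 D v -> L2 D (fun x => a * v x).
Proof.
by move=> /(L2_lin a) /(_ (L2_0 D)); apply: L2_ext => x _; rewrite addr0.
Qed.

Lemma L2_bounded v (M : R) : (mu D < +oo)%E -> measurable_fun D v ->
  (forall x, D x -> `|v x| <= M) -> L2 D v.
Proof.
move=> Doo mv vM; split=> //.
apply: (@le_integrable _ _ _ mu D mD _ (cst (M ^+ 2)%:E) _ _ _).
- by apply/measurable_EFinP; exact: measurable_funX.
- move=> x /vM vxM /=; rewrite lee_fin !normrX lerXn2r ?nnegrE//.
  by apply: le_trans vxM _; exact: ler_norm.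
- apply/integrableP; split; first exact: measurable_cst.
  rewrite integral_cst//= ; apply: lte_mul_pinfty => //.
Qed.

Lemma inner_linl (a : R) v w z : L2 D v -> L2 D w -> L2 D z ->
  inner D (fun x => a * v x + w x) z = a * inner D v z + inner D w z.
Proof.
move=> Lv Lw Lz; rewrite /inner.
under eq_Rintegral do rewrite mulrDl -mulrA.
rewrite RintegralD// ?RintegralZl//.
- exact: L2_mul_integrable.
- have := @L2_mul_integrable _ _ (L2_scale a Lv) Lz.
  by apply: eq_integrable => // x _ /=; rewrite mulrA.
- exact: L2_mul_integrable.
Qed.

Lemma inner_scalel (a : R) v z : L2 D v -> L2 D z ->
  inner D (fun x => a * v x) z = a * inner D v z.
Proof.
move=> Lv Lz; rewrite /inner -RintegralZl//; last exact: L2_mul_integrable.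
by apply: eq_Rintegral => x _; rewrite mulrA.
Qed.

Lemma inner_aeq v v' z : L2 D v -> L2 D v' -> L2 D z -> ae_eq mu D v v' ->
  inner D v z = inner D v' z.
Proof.
move=> [mv _] [mv' _] [mz _] vv'; congr fine; apply: ae_eq_integral => //.
- by apply/measurable_EFinP; exact: measurable_funM.
- by apply/measurable_EFinP; exact: measurable_funM.
- by apply: filterS vv' => x vx Dx; rewrite vx.
Qed.

Lemma inner_vecE F G : (forall i, L2 D (fun x => F x ord0 i)) ->
  (forall i, L2 D (fun x => G x ord0 i)) ->
  inner_vec D F G = \sum_i inner D (fun x => F x ord0 i) (fun x => G x ord0 i).
Proof.
move=> LF LG; rewrite /inner_vec /Rintegral.
under eq_integral do rewrite -sumEFin.
rewrite integral_sum//; last by move=> i; exact: L2_mul_integrable.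
rewrite -[RHS]/(fine (EFin _)) -sumEFin; congr fine; apply: eq_bigr => i _.
by rewrite fineK//; apply: integrable_fin_num => //; exact: L2_mul_integrable.
Qed.

End measurable_domain.

Lemma inner_vecC D F G : inner_vec D F G = inner_vec D G F.
Proof. by apply: eq_Rintegral => x _; apply: eq_bigr => i _; rewrite mulrC. Qed.

Lemma inner_vec_ge0 D F : 0 <= inner_vec D F F.
Proof.
by apply: Rintegral_ge0 => x _; apply: sumr_ge0 => i _; rewrite -expr2 sqr_ge0.
Qed.

Lemma Rintegral_subset D D' v : D' `<=` D -> (forall x, ~ D' x -> v x = 0) ->
  \int[mu]_(x in D) v x = \int[mu]_(x in D') v x.
Proof.
move=> DD v0; rewrite -[in RHS](setIidr DD) Rintegral_mkcondr.
apply: eq_Rintegral => x _; rewrite patchE; case: ifPn => // /negP.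
by rewrite inE => /v0.
Qed.

(** By disjointness at most one truncation of [v] is nonzero at a point, and off the cells [v] is
    zero; so [v] is the sum of its truncations at every point, and the integral splits. *)
Lemma Rintegral_cells (I : finType) (K : I -> set U) D v : measurable D ->
  (forall i, measurable (K i)) -> (forall i, K i `<=` D) -> trivIset setT K ->
  (forall i, mu.-integrable (K i) (EFin \o v)) ->
  (forall x, (forall i, ~ K i x) -> v x = 0) ->
  \int[mu]_(x in D) v x = \sum_i \int[mu]_(x in K i) v x.
Proof.
move=> mD mK KD tK iv v0.
have iK i : mu.-integrable D (fun x => ((v \_ (K i)) x)%:E).
  rewrite (_ : (fun _ => _) = (EFin \o v) \_ (K i)); last by rewrite restrict_EFin.
  apply: (@integrableS _ _ _ mu setT) => //.
  by apply/(integrable_mkcond _ (mK i)).1.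
transitivity (\int[mu]_(x in D) \sum_i (v \_ (K i)) x).
  apply: eq_Rintegral => x _; have [[i Kix]|nK] := pselect (exists i, K i x).
    rewrite (bigD1 i)//= patchE mem_set// big1 ?addr0// => j ji.
    rewrite patchE memNset// => Kjx; move/eqP: ji; apply.
    by apply: tK => //; exists x.
  rewrite v0 => [|i Kix]; last by apply: nK; exists i.
  rewrite big1// => i _; rewrite patchE memNset// => Kix.
  by apply: nK; exists i.
rewrite /Rintegral; under eq_integral do rewrite -sumEFin.
rewrite integral_sum//.
rewrite -[RHS]/(fine (EFin _)) -sumEFin; congr fine; apply: eq_bigr => i _.
rewrite fineK; last exact: integrable_fin_num.
rewrite -[in RHS](setIidr (KD i)) integral_mkcondr.
by apply: eq_integral => x _; rewrite restrict_EFin.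
Qed.

End L2.

(** * Smooth bump functions *)

(** Left, the product rule for [P * w ^- k * exp (- c / w)]; right, the same value in the form of
    [expfam] with exponent [k.+2]. The case [k = 0] is apart because [k.-1] truncates. *)
Lemma expfam_derivative_identity (F : fieldType) (c E p dp v dw : F) k : v != 0 ->
  p * v ^- k * (E * - c * - v ^- 2 * dw) +
  E * (p * (k%:R * v ^- k.-1 * (- v ^- 2 * dw)) + v ^- k * dp) =
  (dp * v * v - k%:R * (p * dw * v) + c * p * dw) / v ^+ k.+2 * E.
Proof.
move=> v0; case: k => [|k] /=; first by rewrite !expr0 expr2 invr1; field.
rewrite !(exprS v k.+2) !(exprS v k.+1) !(exprS v k) expr2.
have := expf_neq0 k v0; move: (v ^+ k) (k.+1%:R : F) => x m x0.
by field; rewrite v0 x0.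
Qed.

Section expfam.
Context {R : realType}.
Implicit Types (w P : {poly R}) (c t : R) (k : nat).

(* Carrying the factors [P] and [w ^- k] makes this family closed under
   differentiation, see [is_derive_expfam]; hence its smoothness. *)
Definition expfam w c P k t : R :=
  if 0 < w.[t] then P.[t] * w.[t] ^- k * expR (- (c / w.[t])) else 0.

(** Only the term of degree [k + 2] of the series of [expR (c / y)] is kept. The spare factor
    [y ^+ 2] is what forces a zero derivative where [w] vanishes. *)
Lemma expR_neg_le c k : 0 < c ->
  exists2 C : R, 0 <= C & forall y, 0 < y -> y ^- k * expR (- (c / y)) <= C * y ^+ 2.
Proof.
move=> c0; exists (k.+2`!%:R / c ^+ k.+2).
  by rewrite divr_ge0// exprn_ge0// ltW.
move=> y y0; have cy0 : 0 <= c / y by rewrite divr_ge0 ?ltW.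
have := expR_ge1Dxn k.+1 cy0; rewrite expr_div_n => H.
have {}H : c ^+ k.+2 / y ^+ k.+2 / k.+2`!%:R <= expR (c / y).
  by apply: le_trans H; rewrite lerDr.
rewrite expRN.
have f0 : 0 < k.+2`!%:R :> R by rewrite ltr0n fact_gt0.
have ck : 0 < c ^+ k.+2 by rewrite exprn_gt0.
have yk : 0 < y ^+ k.+2 by rewrite exprn_gt0.
have -> : k.+2`!%:R / c ^+ k.+2 * y ^+ 2 =
    y ^- k * (c ^+ k.+2 / y ^+ k.+2 / k.+2`!%:R)^-1.
  rewrite -addn2 !exprD; field.
  by rewrite !expf_neq0 ?gt_eqF// pnatr_eq0 -lt0n fact_gt0.
rewrite ler_wpM2l ?invr_ge0 ?exprn_ge0 ?(ltW y0)// lef_pV2 ?posrE ?expR_gt0//.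
by rewrite !divr_gt0.
Qed.

Lemma poly_locally_bounded P t : exists2 M : R, 0 <= M &
  forall s, `|s - t| <= 1 -> `|P.[s]| <= M.
Proof.
have cP : {within `[t - 1, t + 1], continuous (fun s => `|P.[s]|)}.
  apply: continuous_subspaceT => x.
  by apply: (continuous_comp (@continuous_horner _ P x)); exact: norm_continuous.
have [] := EVT_max _ cP; first lra.
move=> m _ Pm; exists `|P.[m]| => // s; rewrite ler_distl => st.
by apply: Pm; rewrite in_itv.
Qed.

(** Where [w] is positive this is the chain rule. If [w.[t] <= 0], then wherever [w.[s] > 0] one has
    [w.[s] <= w.[s] - w.[t] = q.[s] * (s - t)], so [expR_neg_le] bounds the function by a multiple
    of [(s - t) ^+ 2] and its derivative at [t] is 0. This treats [w.[t] = 0] and [w.[t] < 0]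
    together. *)
Lemma is_derive_expfam w c P k t : 0 < c ->
  is_derive t 1 (expfam w c P k)
    (expfam w c (P^`() * w ^+ 2 - P * w^`() * w *+ k + c *: P * w^`()) k.+2 t).
Proof.
move=> c0; rewrite {2}/expfam; have [w0|w0] := ltP 0 w.[t].
  have wt0 : w.[t] != 0 by rewrite gt_eqF.
  pose g := (fun s => P.[s]) * (fun s => ((fun s => w.[s]) s)^-1) ^+ k *
     (expR \o (fun s => - c * ((fun s => w.[s]) s)^-1)).
  have dV : is_derive t 1 (fun s => ((fun s => w.[s]) s)^-1) (- w.[t] ^- 2 *: w^`().[t]).
    exact: is_deriveV.
  have dE := is_derive1_comp (is_derive_expR _) (is_deriveZ (- c) dV).
  have dP := is_deriveM (is_deriveM (is_derive_poly P t) (is_deriveX k dV)) dE.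
  have dg : is_derive t 1 g ((P^`() * w ^+ 2 - P * w^`() * w *+ k +
      c *: P * w^`()).[t] * w.[t] ^- k.+2 * expR (- (c / w.[t]))).
    apply: is_derive_eq dP _.
    rewrite /= !fctE !hornerE /GRing.scale /=.
    rewrite !hornerMn !hornerM -[X in (_ - X + _) / _]mulr_natl !exprVn mulNr.
    by rewrite -(expfam_derivative_identity _ _ _ _ _ k wt0).
  have w_near : \forall s \near t, 0 < w.[s].
    exact: (cvgr_gt _ (@continuous_horner _ w t)).
  have gE : \forall s \near t, g s = expfam w c P k s.
    by apply: filterS w_near => s s0; rewrite /expfam s0 /g /= !fctE /= exprVn mulNr.
  exact: near_eq_is_derive gE dg.
have f0 : expfam w c P k t = 0 by rewrite /expfam ltNge w0.
have [M M0 PM] := poly_locally_bounded P t.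
have [C C0 eC] := expR_neg_le k c0.
have : root (w - w.[t]%:P) t by rewrite /root !hornerE subrr.
move=> /factor_theorem[q /(canRL (addrNK _)) wE].
have [L L0 qL] := poly_locally_bounded q t.
have bnd s : `|s - t| <= 1 -> `|expfam w c P k s| <= M * C * L ^+ 2 * `|s - t| ^+ 2.
  move=> st; rewrite /expfam; case: ifPn => ws; last by rewrite normr0 !mulr_ge0.
  rewrite -mulrA normrM -!mulrA ler_pM ?PM//.
  rewrite ger0_norm; last first.
    by rewrite mulr_ge0 ?expR_ge0// invr_ge0 exprn_ge0// ltW.
  apply: le_trans (eC _ ws) _; apply: ler_wpM2l => //.
  rewrite mulrA -expr2 -exprMn lerXn2r ?nnegrE ?mulr_ge0 ?(ltW ws)//.
  apply: le_trans (_ : `|w.[s] - w.[t]| <= _); first by apply: le_trans (ler_norm _); lra.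
  have -> : w.[s] - w.[t] = q.[s] * (s - t) by rewrite {1}wE !hornerE; ring.
  by rewrite normrM ler_wpM2r// qL.
suff cv : (fun h => h^-1 *: ((expfam w c P k \o shift t) (h *: 1) - expfam w c P k t))
    @ 0^' --> (0 : R).
  by split; [apply/cvg_ex; exists 0|apply/cvg_lim].
have B0 : 0 <= M * C * L ^+ 2 by rewrite !mulr_ge0.
apply/cvgr0Pnorm_le => e e0; near=> h.
have h0 : 0 < `|h| by rewrite normr_gt0; near: h; exact: nbhs_dnbhs_neq.
rewrite f0 subr0 /= normrZ normfV ler_pdivrMl//.
have := bnd (h *: 1 + t); rewrite addrK /GRing.scale /= mulr1 => bh.
apply: le_trans (bh _) _; first by near: h; exact: dnbhs0_le.
rewrite expr2 mulrCA ler_pM2l//.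
(* The added 1 makes the factor positive, so that [e] can be divided by it. *)
apply: (@le_trans _ _ ((M * C * L ^+ 2 + 1) * `|h|)); first by rewrite ler_wpM2r// lerDl.
rewrite -ler_pdivlMl ?ltr_wpDl// mulrC.
by near: h; apply: dnbhs0_le; rewrite divr_gt0// ltr_wpDl.
Unshelve. all: by end_near. Qed.

Lemma expfam_eq0 w c P k t : w.[t] <= 0 -> expfam w c P k t = 0.
Proof. by rewrite /expfam ltNge => ->. Qed.

Lemma expfam_itv w c t : 0 <= c -> 0 <= expfam w c 1 0 t <= 1.
Proof.
move=> c0; rewrite /expfam; case: ifPn => [w0|_]; last by rewrite lexx ler01.
rewrite hornerC expr0 invr1 !mul1r expR_ge0/= -expR0 ler_expR.
by rewrite oppr_le0 divr_ge0// ltW.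
Qed.

Lemma cvg_expfam w t : 0 < w.[t] -> expfam w n.+1%:R^-1 1 0 t @[n --> \oo] --> (1 : R).
Proof.
move=> w0; rewrite /expfam w0 hornerC expr0 invr1 mulr1.
under eq_fun do rewrite mul1r.
suff : - (n.+1%:R^-1 / w.[t]) @[n --> \oo] --> (- (0 / w.[t]) : R).
  rewrite mul0r oppr0 => /cvg_comp /(_ (@continuous_expR R 0)).
  by rewrite expR0.
apply: cvgN; apply: cvgMr_tmp.
exact: cvg_harmonic.
Qed.

End expfam.

(** * Products of functions of one coordinate *)

Section product_of_coordinates.
Context {R : realType} {d : nat}.
Implicit Types (h : 'I_d -> R -> R) (x : 'rV[R]_d).

Definition coord_prod h : 'rV[R]_d -> R := fun x => \prod_i h i (x ord0 i).

Lemma is_derive_coord_prod h j x (dh : R) : is_derive (x ord0 j) 1 (h j) dh ->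
  is_derive x (delta_mx ord0 j) (coord_prod h)
    (dh * \prod_(i | i != j) h i (x ord0 i)).
Proof.
move=> [dhx hE].
have E t : coord_prod h (t *: delta_mx ord0 j + x) =
    \prod_(i | i != j) h i (x ord0 i) * h j (t + x ord0 j).
  rewrite /coord_prod (bigD1 j)//= mulrC; congr (_ * h j _); last first.
    by rewrite !mxE !eqxx mulr1.
  by apply: eq_bigr => i ij; rewrite !mxE (negbTE ij) mulr0 add0r.
have E0 := E 0; rewrite scale0r !add0r in E0.
have {}E : (fun t => t^-1 *: ((coord_prod h \o shift x) (t *: delta_mx ord0 j)
      - coord_prod h x)) =
    (fun t => (\prod_(i | i != j) h i (x ord0 i)) *
      (t^-1 *: ((h j \o shift (x ord0 j)) (t *: 1) - h j (x ord0 j)))).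
  apply/funext => t; rewrite /= E E0.
  by rewrite /GRing.scale /= mulr1 -mulrBr mulrCA.
have cv : (fun t => t^-1 *: ((coord_prod h \o shift x) (t *: delta_mx ord0 j)
    - coord_prod h x)) @ 0^' --> dh * \prod_(i | i != j) h i (x ord0 i).
  rewrite E mulrC; apply: cvgMl_tmp; rewrite -hE; exact: dhx.
by split; [apply/cvg_ex; eexists; exact: cv|apply/cvg_lim].
Qed.

Lemma differentiable_coord_prod h x :
  (forall i, derivable (h i) (x ord0 i) 1) -> differentiable (coord_prod h) x.
Proof.
move=> dh; rewrite /coord_prod.
elim: (index_enum _) => [|i s IHs].
  rewrite (_ : (fun _ => _) = cst 1); first exact: differentiable_cst.
  by apply/funext => y; rewrite big_nil.
rewrite (_ : (fun _ => _) = (h i \o (fun y : 'rV[R]_d => y ord0 i)) *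
   (fun y : 'rV[R]_d => \prod_(j <- s) h j (y ord0 j))).
  apply: differentiableM IHs; apply: differentiable_comp.
    exact: differentiable_coord.
  by apply/derivable1_diffP.
by apply/funext => y; rewrite big_cons.
Qed.

Lemma smooth_coord_prod (S : set (R -> R)) h :
  (forall f, S f -> exists2 g, S g & forall t : R, is_derive t 1 f (g t)) ->
  (forall i, S (h i)) -> smooth (coord_prod h).
Proof.
move=> dS Sh s.
suff [h' Sh' ->] : exists2 h', (forall i, S (h' i)) &
    foldr partial (coord_prod h) s = coord_prod h'.
  move=> x; apply: differentiable_coord_prod => i.
  by have [g _ dg] := dS _ (Sh' i); have [] := dg (x ord0 i).
elim: s => [|j s [h' Sh' /= ->]]; first by exists h.
have [g Sg dg] := dS _ (Sh' j).
exists (fun i => if i == j then g else h' i); first by move=> i; case: ifP.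
apply/funext => x; rewrite /partial.
have [_ ->] := is_derive_coord_prod (dg (x ord0 j)).
rewrite /coord_prod [RHS](bigD1 j)//= eqxx; congr (_ * _).
by apply: eq_bigr => i /negbTE ->.
Qed.

End product_of_coordinates.

Section box_bump.
Context {R : realType} {d : nat}.
Implicit Types (a b x : 'rV[R]_d) (c : R).

Definition box_bump c a b : 'rV[R]_d -> R := coord_prod (fun i =>
  expfam (('X - (a ord0 i)%:P) * ((b ord0 i)%:P - 'X)) c 1 0).

Lemma smooth_box_bump c a b : 0 < c -> smooth (box_bump c a b).
Proof.
move=> c0.
apply: (@smooth_coord_prod _ _ [set f | exists w P k, f = expfam w c P k]).
  move=> _ [w [P [k ->]]].
  exists (expfam w c (P^`() * w ^+ 2 - P * w^`() * w *+ k + c *: P * w^`()) k.+2).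
    by do 3!eexists.
  by move=> t; exact: is_derive_expfam.
by move=> i; do 3!eexists.
Qed.

Lemma box_bump_itv c a b x : 0 <= c -> 0 <= box_bump c a b x <= 1.
Proof.
move=> c0; apply/andP; split.
  by apply: prodr_ge0 => i _; case/andP: (expfam_itv
    (('X - (a ord0 i)%:P) * ((b ord0 i)%:P - 'X)) (x ord0 i) c0).
rewrite -[leRHS](@big1 R 1 *%R _ (index_enum 'I_d) xpredT (fun=> 1))//.
by apply: ler_prod => i _; exact: expfam_itv.
Qed.

(** The order of the corners matters: with [b < a] the product [(x - a) * (b - x)] would be positive
    between [b] and [a]. *)
Lemma box_bump_eq0 c a b x : (forall i, a ord0 i < b ord0 i) -> ~ obox a b x ->
  box_bump c a b x = 0.
Proof.
move=> ab /existsNP[i abx]; rewrite /box_bump /coord_prod (bigD1 i)//= expfam_eq0 ?mul0r//.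
rewrite !hornerE leNgt; apply/negP => H; apply: abx.
have := ab i; case: (ltP (a ord0 i) (x ord0 i)) => /= ?; case: ltP => //=; nra.
Qed.

Lemma cvg_box_bump a b x : obox a b x -> box_bump n.+1%:R^-1 a b x @[n --> \oo] --> (1 : R).
Proof.
move=> abx.
have /= := @cvg_big R 'I_d *%R 1 xpredT (@mul_continuous R) nat \oo (index_enum 'I_d)
  (fun i n => expfam (('X - (a ord0 i)%:P) * ((b ord0 i)%:P - 'X))
    n.+1%:R^-1 1 0 (x ord0 i))
  (fun=> 1) _.
rewrite [\big[_/_]_(_ <- _) 1]big1//; apply => i _.
apply: cvg_expfam; rewrite !hornerE; have /andP[? ?] := abx i.
by rewrite mulr_gt0// subr_gt0.
Qed.
End box_bump.

(** * Test functions and the fundamental lemma *)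

Section test_functions.
Context {R : realType} {d : nat}.
Local Notation U := 'rV[R]_d.
Local Notation mu := (rV_lebesgue R d).
Implicit Types (D : set U) (v g phi : U -> R) (a b x : U).

Lemma smooth_continuous phi : smooth phi -> continuous phi.
Proof. by move=> sphi x; apply: differentiable_continuous; exact: (sphi [::]). Qed.

Lemma smooth_partial i phi : smooth phi -> smooth (partial i phi).
Proof. by move=> sphi s x; have := sphi (rcons s i) x; rewrite foldr_rcons. Qed.

Lemma test_fun_eq0 D phi x : test_fun D phi -> ~ D x -> phi x = 0.
Proof.
move=> [_ _ sD] nDx; apply/eqP/negP => /negP phix; apply/nDx/sD.
exact: subset_closure.
Qed.

Lemma test_fun_subset D D' phi : D `<=` D' -> test_fun D phi -> test_fun D' phi.
Proof. by move=> DD [? ? sD]; split => //; exact: subset_trans sD DD. Qed.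

(** Off its closed support [phi] is locally constant 0, so differentiation does not enlarge the
    support. *)
Lemma test_fun_partial D i phi : test_fun D phi -> test_fun D (partial i phi).
Proof.
move=> [sphi cphi sD].
have sub : closure [set x | partial i phi x != 0] `<=` closure [set x | phi x != 0].
  rewrite [X in _ `<=` X](closure_id _).1; last exact: closed_closure.
  apply: closure_subset => x; apply: contraNP => nx.
  rewrite /partial (@near_eq_derive _ _ _ _ (cst 0)) ?derive_cst//.
  have : open_nbhs x (~` closure [set x | phi x != 0]).
    by split => //; apply: closed_openC; exact: closed_closure.
  move=> /open_nbhs_nbhs; apply: filterS => y ny.
  by apply/eqP/negP => /negP phiy; apply: ny; exact: subset_closure.
split; first exact: smooth_partial.
  by apply: subclosed_compact cphi sub; exact: closed_closure.
exact: subset_trans sD.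
Qed.

Lemma test_fun_bounded D phi : test_fun D phi ->
  exists M : R, forall x, `|phi x| <= M.
Proof.
move=> [sphi cphi _].
have : compact (phi @` closure [set x | phi x != 0]).
  apply: continuous_compact => //; apply: continuous_subspaceT => x.
  exact: smooth_continuous.
move=> /compact_bounded[M [_ phiM]]; exists (`|M| + 1) => x.
have [->|phix] := eqVneq (phi x) 0; first by rewrite normr0 addr_ge0.
apply: (phiM (`|M| + 1)); first by rewrite ltr_pwDr// ler_norm.
by exists x => //; exact: subset_closure.
Qed.

Lemma smooth_measurable D phi : smooth phi -> measurable_fun D phi.
Proof.
by move=> /smooth_continuous/continuous_rV_measurable; exact: measurable_funS.
Qed.

Lemma test_fun_L2 D D' phi : measurable D' -> (mu D' < +oo)%E ->
  test_fun D phi -> L2 D' phi.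
Proof.
move=> mD' fD' tphi; have [M phiM] := test_fun_bounded tphi.
by apply: (L2_bounded mD' (M := M)) => //; apply: smooth_measurable; case: tphi.
Qed.

Lemma cbox_closed a b : closed (cbox a b).
Proof.
rewrite (_ : cbox a b = \bigcap_(i in [set: 'I_d])
    ((fun x : 'rV[R]_d => x ord0 i) @^-1` `[a ord0 i, b ord0 i]%classic)).
  apply: closed_bigI => i _; apply: closed_comp.
    by move=> x _; exact: coord_continuous.
  exact: interval_closed.
apply/seteqP; split => x abx i; last by have := abx i I; rewrite /= in_itv.
by move=> _ /=; rewrite in_itv /=; exact: abx.
Qed.

Lemma cbox_bounded a b : bounded_set (cbox a b).
Proof.
exists (`|a| + `|b|); split; first exact: num_real.
move=> M abM x abx; apply: le_trans (ltW abM).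
rewrite -[leLHS]/(mx_norm x) mx_normrE.
apply/bigmax_leP; split; first exact: addr_ge0.
move=> [i j] _ /=; rewrite ord1; have /andP[ax xb] := abx j.
have na : `|a ord0 j| <= `|a|.
  rewrite -[leRHS]/(mx_norm a) mx_normrE.
  exact: (le_bigmax _ (fun ij => `|a ij.1 ij.2|) (ord0, j)).
have nb : `|b ord0 j| <= `|b|.
  rewrite -[leRHS]/(mx_norm b) mx_normrE.
  exact: (le_bigmax _ (fun ij => `|b ij.1 ij.2|) (ord0, j)).
have := normr_ge0 a; have := normr_ge0 b.
rewrite ler_norml; move: na nb; rewrite !ler_norml => /andP[? ?] /andP[? ?] ? ?.
by apply/andP; split; lra.
Qed.

Lemma test_fun_box_bump D (c : R) a b : 0 < c -> (forall i, a ord0 i < b ord0 i) ->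
  cbox a b `<=` D -> test_fun D (box_bump c a b).
Proof.
move=> c0 ab abD.
have sub : closure [set x | box_bump c a b x != 0] `<=` cbox a b.
  rewrite [X in _ `<=` X](closure_id _).1; last exact: cbox_closed.
  apply: closure_subset => x; apply: contraNP => abx; apply/eqP/box_bump_eq0 => //.
  by move/obox_cbox.
split; [exact: smooth_box_bump| |exact: subset_trans abD].
apply: subclosed_compact sub; first exact: closed_closure.
by apply: bounded_closed_compact; [exact: cbox_bounded|exact: cbox_closed].
Qed.

Lemma integrable_L2 D g : measurable D -> (mu D < +oo)%E -> L2 D g ->
  mu.-integrable D (EFin \o g).
Proof.
move=> mD fD Lg.
have L1 : L2 D (cst 1) by apply: (L2_bounded mD (M := 1)) => // x _; rewrite normr1.
have := L2_mul_integrable mD Lg L1.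
by apply: (eq_integrable mD) => x _ /=; rewrite mulr1.
Qed.

(** The bumps with [c = 1 / (n + 1)] are test functions with values between 0 and 1 that tend to 1
    on the open box; dominated convergence with bound [|g|] passes to the limit. *)
Lemma integral_obox_eq0 D g a b : measurable D -> (mu D < +oo)%E -> L2 D g ->
  (forall phi, test_fun D phi -> inner D g phi = 0) -> cbox a b `<=` D ->
  (\int[mu]_(x in obox a b) (g x)%:E = 0)%E.
Proof.
move=> mD fD Lg g0 abD.
have [ab|nab] := pselect (forall i, a ord0 i < b ord0 i); last first.
  rewrite (_ : obox a b = set0) ?integral_set0//; apply/seteqP; split => // x abx.
  by apply: nab => i; have /andP[/lt_trans] := abx i; apply.
have mab := measurable_obox a b.
have abD' : obox a b `<=` D by apply: subset_trans abD; exact: obox_cbox.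
have ig : mu.-integrable (obox a b) (EFin \o g).
  by apply: (integrableS mD) => //; exact: integrable_L2.
have mg := measurable_int _ ig; move/measurable_EFinP: (mg) => mg'.
have mb n : measurable_fun (obox a b) (fun x => (g x * box_bump n.+1%:R^-1 a b x)%:E).
  apply/measurable_EFinP/measurable_funM => //.
  by apply: smooth_measurable; exact: smooth_box_bump.
have cb : {ae mu, forall x, obox a b x ->
    (fun n => (g x * box_bump n.+1%:R^-1 a b x)%:E) @ \oo --> (EFin \o g) x}.
  apply: aeW => x abx; have := cvgMl_tmp (a := g x) (cvg_box_bump abx).
  rewrite mulr1 => H; apply/fine_cvgP; split; last exact: H.
  by exists 0%N.
have bb : {ae mu, forall x n, obox a b x ->
    (`|(g x * box_bump n.+1%:R^-1 a b x)%:E| <= `|(EFin \o g) x|)%E}.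
  apply: aeW => x n _ /=; rewrite lee_fin normrM ler_piMr//.
  have n0 : 0 <= n.+1%:R^-1 :> R by rewrite invr_ge0.
  have /andP[b0 b1] := box_bump_itv a b x n0.
  by rewrite ger0_norm.
have [_ _] := dominated_convergence mab mb mg cb (integrable_abse ig) bb.
have -> : [sequence (\int[mu]_(x in obox a b) (g x * box_bump n.+1%:R^-1 a b x)%:E)%E]_n
    = cst 0%E.
  apply/funext => n /=.
  have tb : test_fun D (box_bump n.+1%:R^-1 a b) by exact: test_fun_box_bump.
  have : inner D g (box_bump n.+1%:R^-1 a b) = 0 by exact: g0.
  rewrite /inner (Rintegral_subset abD') => [E|x nx]; last first.
    by rewrite box_bump_eq0 ?mulr0.
  rewrite -[RHS]/(0%:E) -E fineK//.
  apply: integrable_fin_num => //; apply: (integrableS mD) => //.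
  by apply: (L2_mul_integrable mD) => //; exact: test_fun_L2 tb.
by move=> /(cvg_unique (@ereal_hausdorff R) (cvg_cst _)).
Qed.

(** Dynkin's lemma: the sets [A] with zero integral over [obox a b] intersected with [A] form a
    lambda-system containing the boxes, which generate the Borel sets. *)
Lemma integral_obox_all_eq0 g a b : mu.-integrable (obox a b) (EFin \o g) ->
  (forall a' b', (forall i, a ord0 i <= a' ord0 i) ->
    (forall i, b' ord0 i <= b ord0 i) ->
    (\int[mu]_(x in obox a' b') (g x)%:E = 0)%E) ->
  forall A, measurable A -> (\int[mu]_(x in obox a b `&` A) (g x)%:E = 0)%E.
Proof.
move=> ig g0; have mab := measurable_obox a b.
pose G := [set A : set U | exists a b, A = obox a b].
have GI : setI_closed G.
  by move=> _ _ [a1 [b1 ->]] [a2 [b2 ->]]; rewrite oboxI; do 2!eexists.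
pose H := [set A : set U | measurable A /\
  (\int[mu]_(x in obox a b `&` A) (g x)%:E = 0)%E].
suff HE : <<d G >> `<=` H.
  move=> A; rewrite rV_measurableE -(setI_closed_g_dynkin_g_sigma_algebra GI).
  by move=> /HE[].
apply: smallest_sub => [|_ [a' [b' ->]]]; last first.
  split; first exact: measurable_obox.
  by rewrite oboxI; apply: g0 => i; rewrite mxE ?le_max ?ge_min lexx.
split.
- by split => //; rewrite setIT; exact: g0.
- move=> A [mA A0]; split; first exact: measurableC.
  have := g0 a b (fun=> lexx _) (fun=> lexx _).
  rewrite -{1}(setUIDK (obox a b) A) integral_setU//.
  + by rewrite A0 add0e setDE.
  + exact: measurableI.
  + exact: measurableD.
  + by rewrite setUIDK; exact: measurable_int ig.
  + by apply/disj_setPS => x [[_ Ax] [_]].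
- move=> F tF HF; have mF k : measurable (F k) by case: (HF k).
  split; first exact: bigcupT_measurable.
  rewrite setI_bigcupr integral_bigcup.
  + by apply: eseries0 => k _ _; case: (HF k).
  + exact: trivIset_setIl.
  + by move=> k; exact: measurableI.
  + apply: (integrableS mab) => //; rewrite -setI_bigcupr.
      by apply: measurableI => //; exact: bigcupT_measurable.
    exact: subIsetl.
Qed.

(** On each box of a countable cover, [g] integrates to zero over every measurable subset, hence is
    null there; countably many negligible sets remain. *)
Lemma fundamental_lemma D g : open D -> (mu D < +oo)%E -> L2 D g ->
  (forall phi, test_fun D phi -> inner D g phi = 0) -> ae_eq mu D g (cst 0).
Proof.
move=> oD fD Lg g0; have mD := open_rV_measurable oD.
have [P [a [b [abD DE]]]] := open_obox_cover oD.
have nk k : P k -> ae_eq mu (obox (a k) (b k)) (EFin \o g) (cst 0%E).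
  move=> Pk; have mab := measurable_obox (a k) (b k).
  have abD' : obox (a k) (b k) `<=` D.
    by apply: subset_trans (abD k Pk); exact: obox_cbox.
  have ig : mu.-integrable (obox (a k) (b k)) (EFin \o g).
    by apply: (integrableS mD) => //; exact: integrable_L2.
  apply: integral_ae_eq => // E Eab mE.
  rewrite integral0 -(setIidr Eab); apply: integral_obox_all_eq0 => // a' b' aa' b'b.
  apply: (@integral_obox_eq0 D) => //.
  apply: subset_trans (abD k Pk) => x abx i; have /andP[ax xb] := abx i.
  by rewrite (le_trans (aa' i) ax) (le_trans xb (b'b i)).
pose N k := if k \in P then ~` [set x | obox (a k) (b k) x -> (g x)%:E = 0%E] else set0.
change (mu.-negligible (~` [set x | D x -> g x = 0])).
apply: (@negligibleS _ _ _ mu (\bigcup_k N k)) => [x /= /not_implyP[+ gx]|].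
  rewrite DE => -[k Pk abx]; exists k => //; rewrite /N mem_set//.
  by move=> /(_ abx) [].
apply: negligible_bigcup => k; rewrite /N; case: ifPn => [/set_mem/nk//|_].
exact: negligible_set0.
Qed.

End test_functions.

(** * Integration by parts *)

Lemma continuous_rV (R : realType) n (T : topologicalType) (f : T -> 'rV[R]_n) :
  (forall i, continuous (fun x => f x ord0 i)) -> continuous f.
Proof.
move=> cf x; apply/cvg_ballP => e e0.
have : \forall y \near x, forall i, ball (f x ord0 i) e (f y ord0 i).
  by apply: filter_forall => i; move/cvg_ballP: (cf i x); apply.
by apply: filterS => y fy; split => // i j; rewrite ord1.
Qed.

Lemma continuous_rV_cons (R : realType) n (t : R) (y : 'rV[R]_n) :
  continuous (fun s : R => rV_cons (s, y)) /\
  continuous (fun z : 'rV[R]_n => rV_cons (t, z)).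
Proof.
split; apply: continuous_rV => i; case: (unliftP ord0 i) => [j|] ->.
- rewrite (_ : (fun _ => _) = cst (y ord0 j)); first exact: cst_continuous.
  by apply/funext => s; rewrite mxE liftK.
- rewrite (_ : (fun _ => _) = id); first by move=> s; exact: cvg_id.
  by apply/funext => s; rewrite mxE unlift_none.
- rewrite (_ : (fun _ => _) = fun z : 'rV[R]_n => z ord0 j).
    by move=> z; exact: coord_continuous.
  by apply/funext => s; rewrite mxE liftK.
- rewrite (_ : (fun _ => _) = cst t); first exact: cst_continuous.
  by apply/funext => s; rewrite mxE unlift_none.
Qed.

Lemma integral_derive_eq0 (R : realType) (h dh : R -> R) (M : R) : 0 < M ->
  continuous dh -> (forall t : R, is_derive t 1 h (dh t)) ->
  (forall t, M < `|t| -> h t = 0 /\ dh t = 0) ->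
  (\int[lebesgue_measure]_t (dh t)%:E = 0)%E.
Proof.
move=> M0 cdh hdh h0.
(* [h] is known to vanish only where [|t|] exceeds [M] strictly, so the endpoints are taken beyond
   [M]. *)
have MM : - (M + 1) < M + 1 by lra.
have dhh t : derivable h t 1 by have [] := hdh t.
have ch : continuous h by move=> t; apply/differentiable_continuous/derivable1_diffP.
have c1 : {within `[- (M + 1), M + 1], continuous dh} by exact: continuous_subspaceT.
have c2 : derivable_oo_LRcontinuous h (- (M + 1)) (M + 1).
  split; first by move=> t _.
  - exact: cvg_at_right_filter (ch _).
  - exact: cvg_at_left_filter (ch _).
have c3 : {in `]- (M + 1), M + 1[, h^`()%classic =1 dh}.
  by move=> t _; rewrite derive1E; have [] := hdh t.
have := continuous_FTC2 MM c1 c2 c3.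
have -> : h (M + 1) = 0 by apply: (h0 _ _).1; rewrite gtr0_norm; lra.
have -> : h (- (M + 1)) = 0 by apply: (h0 _ _).1; rewrite normrN gtr0_norm; lra.
rewrite -EFinB subrr => E; apply: etrans E.
rewrite [RHS]integral_mkcond; apply: eq_integral => t _.
rewrite patchE; case: ifPn => // /negP; rewrite inE /= in_itv /= => nt.
rewrite (h0 t _).2//; rewrite ltNge; apply/negP => tM; apply: nt.
by move: tM; rewrite ler_norml => /andP[? ?]; apply/andP; split; lra.
Qed.

Lemma is_derive_rV_cons0 (R : realType) n (f : 'rV[R]_n.+1 -> R) (t : R)
    (y : 'rV[R]_n) l :
  is_derive (rV_cons (t, y)) (delta_mx ord0 ord0) f l ->
  is_derive t 1 (fun s => f (rV_cons (s, y))) l.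
Proof.
have E0 (h : R) : h *: delta_mx ord0 ord0 + rV_cons (t, y) = rV_cons (h *: 1 + t, y).
  apply/rowP => i; rewrite !mxE eqxx; case: (unliftP ord0 i) => [k ->|->].
    by rewrite eq_sym (negbTE (neq_lift _ _)) mulr0 add0r.
  by rewrite /GRing.scale.
move=> [df fl].
have E : (fun h : R => h^-1 *: ((f \o shift (rV_cons (t, y)))
      (h *: delta_mx ord0 ord0) - f (rV_cons (t, y)))) =
    (fun h => h^-1 *: (((fun s => f (rV_cons (s, y))) \o shift t) (h *: 1) -
      f (rV_cons (t, y)))) by apply/funext => h; rewrite /= E0.
by split; [move: df; rewrite /derivable E|move: fl; rewrite /derive E].
Qed.

Lemma is_derive_rV_cons_lift (R : realType) n (f : 'rV[R]_n.+1 -> R) (t : R)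
    (y : 'rV[R]_n) j l :
  is_derive (rV_cons (t, y)) (delta_mx ord0 (lift ord0 j)) f l ->
  is_derive y (delta_mx ord0 j) (fun z => f (rV_cons (t, z))) l.
Proof.
have E1 (h : R) : h *: delta_mx ord0 (lift ord0 j) + rV_cons (t, y) =
    rV_cons (t, h *: delta_mx ord0 j + y).
  apply/rowP => i; rewrite !mxE eqxx; case: (unliftP ord0 i) => [k ->|->].
    by rewrite !mxE eqxx (inj_eq lift_inj).
  by rewrite (negbTE (neq_lift _ _)) mulr0 add0r.
move=> [df fl].
have E : (fun h : R => h^-1 *: ((f \o shift (rV_cons (t, y)))
      (h *: delta_mx ord0 (lift ord0 j)) - f (rV_cons (t, y)))) =
    (fun h => h^-1 *: (((fun z => f (rV_cons (t, z))) \o shift y)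
      (h *: delta_mx ord0 j) - f (rV_cons (t, y)))).
  by apply/funext => h; rewrite /= E1.
by split; [move: df; rewrite /derivable E|move: fl; rewrite /derive E].
Qed.

Lemma integrable_continuous_cbox (R : realType) n (g : 'rV[R]_n -> R) (M : R) : 0 < M ->
  continuous g -> (forall x, ~ cbox (const_mx (- M)) (const_mx M) x -> g x = 0) ->
  (rV_lebesgue R n).-integrable setT (EFin \o g).
Proof.
move=> M0 cg g0; set B := cbox _ _ in g0.
have mB : measurable B by exact: measurable_cbox.
have [C gC] : exists C : R, forall x, B x -> `|g x| <= C.
  have : compact (g @` B).
    apply: continuous_compact; first exact: continuous_subspaceT.
    by apply: bounded_closed_compact; [exact: cbox_bounded|exact: cbox_closed].
  move=> /compact_bounded[C [_ gC]]; exists (`|C| + 1) => x Bx.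
  by apply: (gC (`|C| + 1)); [rewrite ltr_pwDr// ler_norm|exists x].
have fB : (rV_lebesgue R n B < +oo)%E by exact: rV_lebesgue_cbox_fin (ltW M0).
have mg : measurable_fun B g.
  by apply: measurable_funS (continuous_rV_measurable cg).
have := integrable_L2 mB fB (L2_bounded mB fB mg gC).
move=> /(integrable_mkcond _ mB).1; apply: (eq_integrable measurableT) => x _.
by rewrite /= patchE; case: ifPn => // /negP; rewrite inE => /g0 ->.
Qed.

(** Induction on the dimension, peeling off the first coordinate. If the derivative is along it,
    Fubini puts that variable inside and the fundamental theorem of calculus applies; otherwise each
    slice at fixed first coordinate falls under the induction hypothesis. Taking the derivative as a
    separate function [g] lets slices fit the statement. *)
Lemma integral_partial_eq0 (R : realType) n (f g : 'rV[R]_n -> R) i (M : R) : 0 < M ->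
  continuous g -> (forall x, is_derive x (delta_mx ord0 i) f (g x)) ->
  (forall x, ~ cbox (const_mx (- M)) (const_mx M) x -> f x = 0 /\ g x = 0) ->
  (\int[rV_lebesgue R n]_x (g x)%:E = 0)%E.
Proof.
move=> M0; elim: n f g i => [|n IHn] f g i cg dfg f0; first by case: i dfg.
have ig : (rV_lebesgue R n.+1).-integrable setT (EFin \o g).
  by apply: (integrable_continuous_cbox M0 cg) => x /f0[].
have mg : measurable_fun setT (EFin \o g) := measurable_int _ ig.
have mc := @measurable_rV_cons R n.
have ic : (@lebesgue_measure R \x rV_lebesgue R n)%E.-integrable setT
    ((EFin \o g) \o @rV_cons R n).
  apply/integrableP; split; first exact: measurableT_comp mc.
  move/integrableP: ig => [_]; apply: le_lt_trans.
  rewrite [leRHS](ge0_integral_pushforward mc)//.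
  exact: measurableT_comp.
transitivity (\int[(@lebesgue_measure R \x rV_lebesgue R n)]_z
    ((EFin \o g) \o @rV_cons R n) z)%E.
  exact: (integral_pushforward mc).
have cboxS t y : cbox (const_mx (- M)) (const_mx M) (rV_cons (t, y)) ->
    `|t| <= M /\ cbox (const_mx (- M)) (const_mx M) y.
  move=> ty; split=> [|j].
    by have := ty ord0; rewrite !mxE unlift_none ler_norml.
  by have := ty (lift ord0 j); rewrite !mxE liftK.
case: (unliftP ord0 i) dfg => [j|] -> dfg.
  rewrite -(integral12_prod_meas1 ic); apply: integral0_eq => t _.
  apply: (IHn (fun y => f (rV_cons (t, y))) (fun y => g (rV_cons (t, y))) j).
  - move=> y; exact: (continuous_comp ((continuous_rV_cons t y).2 y) (cg _)).
  - by move=> y; apply: is_derive_rV_cons_lift; exact: dfg.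
  - by move=> y ny; apply: f0 => /cboxS[].
rewrite -(integral21_prod_meas1 ic); apply: integral0_eq => y _.
apply: (integral_derive_eq0 M0 (h := fun t => f (rV_cons (t, y)))
  (dh := fun t => g (rV_cons (t, y)))).
- move=> t; exact: (continuous_comp ((continuous_rV_cons t y).1 t) (cg _)).
- by move=> t; apply: is_derive_rV_cons0; exact: dfg.
- by move=> t; rewrite ltNge => /negP Mt; apply: f0 => /cboxS[/Mt].
Qed.

Section weak_gradient_of_test_functions.
Context {R : realType} {d : nat}.
Local Notation U := 'rV[R]_d.
Local Notation mu := (rV_lebesgue R d).
Implicit Types (D : set U) (phi psi : U -> R).

(** The derivative of [phi * psi] integrates to zero over the whole space, and the support of [phi]
    alone confines that integral to [D]. *)
Lemma integration_by_parts_test D D' phi psi i : measurable D -> (mu D < +oo)%E ->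
  test_fun D phi -> test_fun D' psi ->
  inner D phi (partial i psi) = - inner D (partial i phi) psi.
Proof.
move=> mD fD tphi tpsi.
have [[sphi cphi _] [spsi _ _]] := (tphi, tpsi).
have [tdphi tdpsi] := (test_fun_partial i tphi, test_fun_partial i tpsi).
have [sdphi sdpsi] := (smooth_partial i sphi, smooth_partial i spsi).
have [Lphi Lpsi] := (test_fun_L2 mD fD tphi, test_fun_L2 mD fD tpsi).
have [Ldphi Ldpsi] := (test_fun_L2 mD fD tdphi, test_fun_L2 mD fD tdpsi).
have [M M0 supM] := bounded_set_cbox (compact_bounded cphi).
pose g x := phi x * partial i psi x + partial i phi x * psi x.
have int0 : (\int[mu]_x (g x)%:E = 0)%E.
  apply: (@integral_partial_eq0 _ _ (fun x => phi x * psi x) g i _ M0).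
  - move=> x; apply: (@cvgD _ _ _ (nbhs x) _ (fun x => phi x * partial i psi x)).
      by apply: (@cvgM _ _ (nbhs x) _ phi (partial i psi)); exact: smooth_continuous.
    by apply: (@cvgM _ _ (nbhs x) _ (partial i phi) psi); exact: smooth_continuous.
  - move=> x; have dphi : is_derive x (delta_mx ord0 i) phi (partial i phi x).
      by apply: DeriveDef => //; apply: diff_derivable; exact: (sphi [::]).
    have dpsi : is_derive x (delta_mx ord0 i) psi (partial i psi x).
      by apply: DeriveDef => //; apply: diff_derivable; exact: (spsi [::]).
    apply: is_derive_eq (is_deriveM dphi dpsi) _.
    by rewrite /g /GRing.scale /= [psi x * _]mulrC.
  - move=> x nx; have p0 : ~ closure [set x | phi x != 0] x by move/supM.
    (* Regarding [phi] as a test function on its own support shows that its partial derivative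
       vanishes outside the same cube. *)
    have tc : test_fun (closure [set x | phi x != 0]) phi by split.
    rewrite /g (test_fun_eq0 tc)// (test_fun_eq0 (test_fun_partial i tc))//.
    by rewrite !mul0r addr0.
apply/eqP; rewrite -subr_eq0 opprK; apply/eqP.
rewrite /inner -RintegralD//; [|exact: L2_mul_integrable..].
have -> : \int[mu]_(x in D) (phi x * partial i psi x + partial i phi x * psi x) =
    \int[mu]_x g x.
  apply/esym; apply: Rintegral_subset => // x Dx.
  by rewrite /g (test_fun_eq0 tphi)// (test_fun_eq0 tdphi)// !mul0r addr0.
by rewrite /Rintegral int0.
Qed.

Definition grad phi : U -> U := fun x => \row_i partial i phi x.

Lemma test_fun_is_wgrad D phi : measurable D -> (mu D < +oo)%E ->
  test_fun D phi -> is_wgrad D phi (grad phi).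
Proof.
move=> mD fD tphi.
have gE i : (fun x => grad phi x ord0 i) = partial i phi.
  by apply/funext => x; rewrite mxE.
split=> [i|psi i tpsi]; rewrite gE; last exact: integration_by_parts_test tpsi.
by apply: test_fun_L2 => //; exact: test_fun_partial tphi.
Qed.

End weak_gradient_of_test_functions.

(** * Weak gradients and Laplacians *)

Section weak_gradients.
Context {R : realType} {d : nat}.
Local Notation U := 'rV[R]_d.
Local Notation mu := (rV_lebesgue R d).
Implicit Types (D : set U) (u v w z f phi : U -> R) (F G : U -> U).

Definition L2_vec D F := forall i, L2 D (fun x => F x ord0 i).

Definition aeq_vec D F G :=
  forall i, ae_eq mu D (fun x => F x ord0 i) (fun x => G x ord0 i).

Lemma is_wgrad_ext D v w G : (forall x, D x -> v x = w x) ->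
  is_wgrad D v G -> is_wgrad D w G.
Proof.
move=> vw [LG vG]; split => // phi i tphi.
by rewrite -(vG _ _ tphi); apply: inner_ext => // x /vw.
Qed.

(** Both functions have the same set of weak gradients, so [xget] selects the same element: an
    equality at every point, not merely almost everywhere. *)
Lemma wgrad_ext D v w : (forall x, D x -> v x = w x) -> wgrad D v = wgrad D w.
Proof.
move=> vw; congr (xget _); apply/seteqP; split => G; apply: is_wgrad_ext => //.
by move=> x /vw.
Qed.

Lemma H1_ext D v w : measurable D -> (forall x, D x -> v x = w x) -> H1 D v -> H1 D w.
Proof.
move=> mD vw [Lv [G vG]]; split; first exact: L2_ext Lv.
by exists G; exact: is_wgrad_ext vG.
Qed.

Lemma wgradP D v : H1 D v -> is_wgrad D v (wgrad D v).
Proof. by move=> [_ [G vG]]; exact: (xgetPex (fun=> 0)) (ex_intro _ G vG). Qed.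

Lemma L2_wgrad D v : H1 D v -> L2_vec D (wgrad D v).
Proof. by move=> /wgradP[]. Qed.

Lemma inner_test_subset D D' v phi : D' `<=` D -> test_fun D' phi ->
  inner D v phi = inner D' v phi.
Proof.
move=> DD tphi; apply: Rintegral_subset => // x nx.
by rewrite (test_fun_eq0 tphi)// mulr0.
Qed.

Lemma is_wgrad_subset D D' v G : measurable D -> measurable D' -> D' `<=` D ->
  is_wgrad D v G -> is_wgrad D' v G.
Proof.
move=> mD mD' DD [LG vG]; split=> [i|phi i tphi]; first exact: L2_subset (LG i).
rewrite -!(inner_test_subset _ DD)//; last exact: test_fun_partial.
by apply: vG; exact: test_fun_subset tphi.
Qed.

Lemma H1_subset D D' v : measurable D -> measurable D' -> D' `<=` D ->
  H1 D v -> H1 D' v.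
Proof.
move=> mD mD' DD [Lv [G vG]]; split; first exact: L2_subset Lv.
by exists G; exact: is_wgrad_subset vG.
Qed.

Section domain.
Variables (D : set U) (oD : open D) (fD : (mu D < +oo)%E).
Let mD : measurable D := open_rV_measurable oD.
Let test_L2 phi : test_fun D phi -> L2 D phi := @test_fun_L2 R d D D phi mD fD.

Lemma aeq_inner_test v w : L2 D v -> L2 D w ->
  (forall phi, test_fun D phi -> inner D v phi = inner D w phi) -> ae_eq mu D v w.
Proof.
move=> Lv Lw vw.
have := @fundamental_lemma _ _ D (fun x => -1 * w x + v x) oD fD (L2_lin mD _ Lw Lv).
have H : forall phi, test_fun D phi -> inner D (fun x => -1 * w x + v x) phi = 0.
  move=> phi tphi; rewrite inner_linl//; last exact: test_L2.
  by rewrite (vw phi tphi) mulN1r addNr.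
move=> /(_ H); apply: filterS => x /= wv Dx; have := wv Dx.
by rewrite mulN1r addrC => /subr0_eq.
Qed.

Lemma is_wgrad_unique v F G : is_wgrad D v F -> is_wgrad D v G -> aeq_vec D F G.
Proof.
move=> [LF vF] [LG vG] i; apply: aeq_inner_test => // phi tphi.
by apply: oppr_inj; rewrite -(vF _ _ tphi) -(vG _ _ tphi).
Qed.

Lemma inner_vec_aeql F F' G : L2_vec D F -> L2_vec D F' -> L2_vec D G ->
  aeq_vec D F F' -> inner_vec D F G = inner_vec D F' G.
Proof.
move=> LF LF' LG FF; rewrite !inner_vecE//; apply: eq_bigr => i _.
exact: inner_aeq.
Qed.

Lemma inner_vec_linl (a : R) F G H : L2_vec D F -> L2_vec D G -> L2_vec D H ->
  inner_vec D (fun x => a *: F x + G x) H = a * inner_vec D F H + inner_vec D G H.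
Proof.
move=> LF LG LH.
have E i : (fun x => (a *: F x + G x) ord0 i) =
    (fun x => a * F x ord0 i + G x ord0 i) by apply/funext => x; rewrite !mxE.
rewrite !inner_vecE// => [|i]; last by rewrite E; exact: L2_lin.
rewrite mulr_sumr -big_split; apply: eq_bigr => i _ /=.
by rewrite E inner_linl.
Qed.

Lemma inner_vec_scalel (a : R) F G : L2_vec D F -> L2_vec D G ->
  inner_vec D (fun x => a *: F x) G = a * inner_vec D F G.
Proof.
move=> LF LG.
have E i : (fun x => (a *: F x) ord0 i) = (fun x => a * F x ord0 i).
  by apply/funext => x; rewrite !mxE.
rewrite !inner_vecE// => [|i]; last by rewrite E; exact: L2_scale.
by rewrite mulr_sumr; apply: eq_bigr => i _; rewrite E inner_scalel.
Qed.

Lemma is_wgrad_lin (a : R) v w F G : L2 D v -> L2 D w ->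
  is_wgrad D v F -> is_wgrad D w G ->
  is_wgrad D (fun x => a * v x + w x) (fun x => a *: F x + G x).
Proof.
move=> Lv Lw [LF vF] [LG vG].
have E i : (fun x => (a *: F x + G x) ord0 i) =
    (fun x => a * F x ord0 i + G x ord0 i) by apply/funext => x; rewrite !mxE.
split=> [i|phi i tphi]; rewrite E; first exact: L2_lin.
rewrite !inner_linl//; [|exact: test_L2|exact/test_L2/test_fun_partial].
by rewrite (vF _ _ tphi) (vG _ _ tphi) mulrN opprD.
Qed.

Lemma H1_lin (a : R) v w : H1 D v -> H1 D w -> H1 D (fun x => a * v x + w x).
Proof.
move=> [Lv [F vF]] [Lw [G wG]]; split; first exact: L2_lin.
by exists (fun x => a *: F x + G x); exact: is_wgrad_lin.
Qed.

Definition dirichlet v w : R := inner_vec D (wgrad D v) (wgrad D w).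

(** The gradient chosen for [a * v + w] agrees only almost everywhere with the combination of the
    chosen gradients, which suffices under the integral. *)
Lemma dirichlet_linl (a : R) v w z : H1 D v -> H1 D w -> H1 D z ->
  dirichlet (fun x => a * v x + w x) z = a * dirichlet v z + dirichlet w z.
Proof.
move=> Hv Hw Hz; have [[Lv _] [Lw _]] := (Hv, Hw).
rewrite /dirichlet -inner_vec_linl; [|exact: L2_wgrad..].
have L := is_wgrad_lin a Lv Lw (wgradP Hv) (wgradP Hw).
apply: inner_vec_aeql; [|by case: L| |].
- by apply: L2_wgrad; exact: H1_lin.
- exact: L2_wgrad.
- by apply: is_wgrad_unique L; apply: wgradP; exact: H1_lin.
Qed.

Lemma dirichlet_is_wgradl v w F : H1 D v -> H1 D w -> is_wgrad D v F ->
  dirichlet v w = inner_vec D F (wgrad D w).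
Proof.
move=> Hv Hw vF; apply: inner_vec_aeql; [exact: L2_wgrad|by case: vF|exact: L2_wgrad|].
by apply: is_wgrad_unique vF; exact: wgradP.
Qed.

Lemma is_wgrad_aeq0 v : L2 D v -> ae_eq mu D v (cst 0) -> is_wgrad D v (fun=> 0).
Proof.
move=> Lv v0; have E i : (fun x : U => (0 : U) ord0 i) = fun=> 0.
  by apply/funext => x; rewrite mxE.
have in0 phi : inner D (fun=> 0) phi = 0.
  by rewrite /inner; under eq_Rintegral do rewrite mul0r; rewrite Rintegral_cst// mul0r.
split=> [i|phi i tphi]; rewrite E; first exact: L2_0.
rewrite in0 oppr0 (inner_aeq mD (v' := fun=> 0))//; first exact: L2_0.
by apply/test_L2/test_fun_partial.
Qed.

Lemma aeq0_forms v : L2 D v -> ae_eq mu D v (cst 0) ->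
  [/\ H1 D v, inner D v v = 0 & dirichlet v v = 0].
Proof.
move=> Lv v0; have vG := is_wgrad_aeq0 Lv v0.
have Hv : H1 D v by split=> //; exists (fun=> 0).
split=> //.
  rewrite (inner_aeq mD (v' := fun=> 0))//; last exact: L2_0.
  by rewrite /inner; under eq_Rintegral do rewrite mul0r; rewrite Rintegral_cst// mul0r.
rewrite (dirichlet_is_wgradl _ _ vG)// /inner_vec.
rewrite (@eq_Rintegral _ _ _ _ _ (fun=> 0)); first by rewrite Rintegral_cst// mul0r.
by move=> x _; rewrite big1// => i _; rewrite mxE mul0r.
Qed.

(** Reduced to [inner_vecE] for the field with all entries [v] and the field with entries [h i]. *)
Lemma inner_sumr v (h : 'I_d -> U -> R) : L2 D v -> (forall i, L2 D (h i)) ->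
  inner D v (fun x => \sum_i h i x) = \sum_i inner D v (h i).
Proof.
move=> Lv Lh.
pose F (x : U) : U := \row_i v x; pose H (x : U) : U := \row_i h i x.
have FE i : (fun x => F x ord0 i) = v by apply/funext => x; rewrite mxE.
have HE i : (fun x => H x ord0 i) = h i by apply/funext => x; rewrite mxE.
transitivity (inner_vec D F H); last first.
  rewrite inner_vecE//; first by apply: eq_bigr => i _; rewrite FE HE.
    by move=> i; rewrite FE.
  by move=> i; rewrite HE.
apply: eq_Rintegral => x _; rewrite mulr_sumr.
by apply: eq_bigr => i _; rewrite !mxE.
Qed.

Lemma test_fun_H10 phi : test_fun D phi -> H10 D phi.
Proof.
move=> tphi; split.
  split; first exact: test_L2.
  by exists (grad phi); exact: test_fun_is_wgrad.
move=> e e0; exists phi => //; set z := fun _ => _.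
have z0 : z = fun=> 0 by apply/funext => x; rewrite /z subrr.
(* Even for the zero function [wgrad] is a chosen representative, so its zero seminorm rests on
   uniqueness. *)
have [_ i0 d0] : [/\ H1 D z, inner D z z = 0 & dirichlet z z = 0].
  by rewrite z0; apply: aeq0_forms; [exact: L2_0|exact: aeW].
rewrite /normH1 /normL2 /seminormH1 i0 -/(dirichlet z z) d0.
by rewrite sqrtr0 expr0n addr0 sqrtr0.
Qed.

Lemma wlapP v g : L2 D g -> (forall phi, test_fun D phi ->
    inner D v (fun x => \sum_i partial i (partial i phi) x) = inner D g phi) ->
  L2 D (wlap D v) /\ ae_eq mu D (wlap D v) g.
Proof.
move=> Lg vg.
have [Ll vl] : [set g : U -> R | L2 D g /\ forall phi, test_fun D phi ->
    inner D v (fun x => \sum_i partial i (partial i phi) x) = inner D g phi] (wlap D v).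
  by apply: (xgetPex (fun=> 0)); exists g.
by split=> //; apply: aeq_inner_test => // phi tphi; rewrite -vl// vg.
Qed.

End domain.

(** In the weak equation tested with [phi], the chosen gradient of [phi] is exchanged for the
    classical one; the definition of the weak gradient of [u] then moves the remaining derivative
    onto [phi]. *)
Lemma weak_solution_lap D (alpha beta : R) f u : open D -> (mu D < +oo)%E ->
  0 < alpha -> L2 D f -> weak_solution D alpha beta f u ->
  forall phi, test_fun D phi ->
    inner D u (fun x => \sum_i partial i (partial i phi) x) =
    inner D (fun x => alpha^-1 * (beta * u x + -1 * f x)) phi.
Proof.
move=> oD fD a0 Lf [[Hu _] wu] phi tphi; have mD := open_rV_measurable oD.
have [Lu _] := Hu.
have L2phi := test_fun_L2 mD fD tphi.
have Ldphi i : L2 D (partial i phi) by apply: test_fun_L2 => //; exact: test_fun_partial tphi.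
have tgrad := test_fun_is_wgrad mD fD tphi.
have Hphi : H10 D phi by exact: test_fun_H10.
rewrite inner_sumr//; last first.
  move=> i; apply: test_fun_L2 => //; do 2 apply: test_fun_partial; exact: tphi.
have := wu _ Hphi.
have [_ uG] := wgradP Hu.
(* The arguments are swapped because gradients can be exchanged in the left slot only. *)
rewrite inner_vecC -/(dirichlet D phi u) (dirichlet_is_wgradl oD fD _ _ tgrad)//; last by case: Hphi.
rewrite inner_vecC inner_vecE//; [|exact: L2_wgrad|by case: tgrad].
have Lbf : L2 D (fun x => beta * u x + -1 * f x).
  by apply: (L2_lin mD) => //; exact: L2_scale.
rewrite inner_scalel// inner_linl//; last exact: L2_scale.
rewrite inner_scalel// => <-.
have -> : \sum_i inner D (fun x => wgrad D u x ord0 i) (fun x => grad phi x ord0 i) =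
    - \sum_i inner D u (partial i (partial i phi)).
  rewrite -sumrN; apply: eq_bigr => i _.
  rewrite uG; last exact: test_fun_partial.
  by rewrite opprK; congr (inner _ _ _); apply/funext => x; rewrite mxE.
by field; rewrite gt_eqF.
Qed.

(** Test functions on [D'] are test functions on [D], so the Laplacian identity localises:
    [alpha * wlap D' u = beta * u - f] almost everywhere on [D']. Substituting it in the duality
    pairing gives the formula. *)
Lemma normal_flux_weak_solution D D' (alpha beta : R) f u w : open D ->
  (mu D < +oo)%E -> open D' -> D' `<=` D -> 0 < alpha -> L2 D f ->
  weak_solution D alpha beta f u -> H1 D' w ->
  normal_flux D' alpha u w =
    alpha * dirichlet D' u w + beta * inner D' u w - inner D' f w.
Proof.
move=> oD fD oD' DD a0 Lf wu Hw; have [[Hu _] _] := wu.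
have [mD mD'] := (open_rV_measurable oD, open_rV_measurable oD').
have fD' : (mu D' < +oo)%E.
  by apply: le_lt_trans fD; apply: le_measure; rewrite ?inE.
have [Lu Lf'] : L2 D' u /\ L2 D' f by case: Hu => ? _; split; exact: L2_subset DD _.
have Hu' : H1 D' u by exact: H1_subset DD Hu.
have [Lw _] := Hw.
pose h x := beta * u x + -1 * f x.
have Lh : L2 D' h by apply: (L2_lin mD') => //; exact: L2_scale.
have lap phi : test_fun D' phi ->
    inner D' u (fun x => \sum_i partial i (partial i phi) x) =
    inner D' (fun x => alpha^-1 * h x) phi.
  move=> tphi; rewrite -(inner_test_subset _ DD tphi).
  rewrite -(weak_solution_lap oD fD a0 Lf wu (test_fun_subset DD tphi)).
  apply/esym/Rintegral_subset => // x nx; rewrite big1 ?mulr0// => i _.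
  by apply: (test_fun_eq0 _ nx); do 2 apply: test_fun_partial.
have [Ll lE] := wlapP oD' fD' (L2_scale mD' alpha^-1 Lh) lap.
rewrite /normal_flux inner_vec_scalel//; [|exact: L2_wgrad..].
rewrite -addrA; congr (_ + _).
rewrite inner_scalel// (inner_aeq mD' _ _ _ lE)//; last exact: L2_scale.
rewrite inner_scalel// mulVKf ?gt_eqF// /h inner_linl//; last exact: L2_scale.
by rewrite !inner_scalel// mulN1r.
Qed.

End weak_gradients.

(** * Broken forms *)

Section semi_inner_product.
Context {R : realType} {X : Type}.
Implicit Types (H : set (X -> R)) (B : (X -> R) -> (X -> R) -> R) (v w z : X -> R).

Definition lin_closed H := forall (a : R) v w, H v -> H w ->
  H (fun x => a * v x + w x).

(** Definiteness is absent, since the forms vanish on null functions. Symmetry and positivity hold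
    pointwise under the integral for all functions, whereas linearity needs integrability and is
    restricted to [H]. *)
Definition semi_inner H B := [/\ lin_closed H, forall v w, B v w = B w v,
  forall v, 0 <= B v v & forall (a : R) v w z, H v -> H w -> H z ->
    B (fun x => a * v x + w x) z = a * B v z + B w z].

Lemma semi_inner_sqr H B (a : R) v w : semi_inner H B -> H v -> H w ->
  B (fun x => a * v x + w x) (fun x => a * v x + w x) =
  a ^+ 2 * B v v + 2 * a * B v w + B w w.
Proof.
move=> [cH Bs _ Bl] Hv Hw; have Hvw := cH a _ _ Hv Hw.
rewrite Bl// (Bs v) (Bs w) !Bl// (Bs w v); ring.
Qed.

Lemma cauchy_schwarz H B v w : semi_inner H B -> H v -> H w ->
  `|B v w| <= Num.sqrt (B v v) * Num.sqrt (B w w).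
Proof.
move=> sB Hv Hw; have [_ Bs B0 _] := sB.
rewrite -sqrtrM ?B0// -sqrtr_sqr ler_wsqrtr//.
(* The quadratic form of [a * v + b * w]. Only combinations with coefficient 1 on [w] are available,
   hence the scaling by [b] and the separate case [b = 0]. *)
have P (a b : R) : 0 <= a ^+ 2 * B v v + 2 * a * b * B v w + b ^+ 2 * B w w.
  have [->|b0] := eqVneq b 0.
    by rewrite expr0n mulr0 !mul0r !addr0 mulr_ge0 ?sqr_ge0.
  have := B0 (fun x => (a / b) * v x + w x); rewrite (semi_inner_sqr _ sB)// => Q.
  rewrite (_ : _ + _ + _ = b ^+ 2 * ((a / b) ^+ 2 * B v v + 2 * (a / b) * B v w + B w w)).
    by rewrite mulr_ge0// sqr_ge0.
  by field.
have [v0|v0] := eqVneq (B v v) 0; last first.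
  have vp : 0 < B v v by rewrite lt_neqAle eq_sym v0 B0.
  (* Up to scaling, the minimiser of the quadratic form; it leaves [B v v] times the Cauchy-Schwarz
     defect. *)
  have := P (B v w) (- B v v).
  rewrite (_ : _ + _ + _ = B v v * (B v v * B w w - B v w ^+ 2)); last by ring.
  by rewrite pmulr_rge0// subr_ge0.
have [->|B1] := eqVneq (B v w) 0; first by rewrite expr0n v0 mul0r.
(* With [B v v = 0] the form is affine in its first parameter; this value makes it [- 2 - B w w],
   which is negative, a contradiction. *)
have := P (- (1 + B w w) / B v w) 1; rewrite v0.
rewrite (_ : _ + _ + _ = - 2 - B w w); last by field.
by have := B0 w; lra.
Qed.

Lemma semi_norm_lin H B (a : R) v w : semi_inner H B -> H v -> H w ->
  Num.sqrt (B (fun x => a * v x + w x) (fun x => a * v x + w x)) <=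
  `|a| * Num.sqrt (B v v) + Num.sqrt (B w w).
Proof.
move=> sB Hv Hw; have [_ _ B0 _] := sB.
rewrite -[leRHS]ger0_norm ?addr_ge0 ?mulr_ge0 ?sqrtr_ge0// -sqrtr_sqr ler_wsqrtr//.
rewrite (semi_inner_sqr _ sB)// sqrrD exprMn !sqr_sqrtr// real_normK ?num_real//.
rewrite lerD2r lerD2l; apply: le_trans (ler_norm _) _.
rewrite !normrM (ger0_norm (ler0n _ 2)) -mulr_natl.
have := cauchy_schwarz sB Hv Hw; have := normr_ge0 a; nra.
Qed.

Lemma semi_inner_sum (I : finType) (H : I -> set (X -> R))
    (B : I -> (X -> R) -> (X -> R) -> R) :
  (forall i, semi_inner (H i) (B i)) ->
  semi_inner [set v | forall i, H i v] (fun v w => \sum_i B i v w).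
Proof.
move=> sB; split.
- by move=> a v w Hv Hw i; have [cH _ _ _] := sB i; exact: cH.
- by move=> v w; apply: eq_bigr => i _; have [_ Bs _ _] := sB i.
- by move=> v; apply: sumr_ge0 => i _; have [_ _ B0 _] := sB i.
- move=> a v w z Hv Hw Hz; rewrite mulr_sumr -big_split; apply: eq_bigr => i _.
  by have [_ _ _ Bl] := sB i; exact: Bl.
Qed.

Lemma semi_inner_comb H B B' (a b : R) : 0 <= a -> 0 <= b ->
  semi_inner H B -> semi_inner H B' -> semi_inner H (fun v w => a * B v w + b * B' v w).
Proof.
move=> a0 b0 [cH Bs B0 Bl] [_ Bs' B0' Bl']; split => //.
- by move=> v w; rewrite Bs Bs'.
- by move=> v; rewrite addr_ge0// mulr_ge0.
- by move=> c v w z Hv Hw Hz; rewrite Bl// Bl'//; ring.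
Qed.

End semi_inner_product.

(** * Mass, stiffness and energy forms summed over the cells *)

Section broken_forms.
Context {R : realType} {d : nat} {I : finType} (K : I -> set 'rV[R]_d).
Local Notation U := 'rV[R]_d.
Local Notation mu := (rV_lebesgue R d).
Hypotheses (oK : forall i, open (K i)) (fK : forall i, (mu (K i) < +oo)%E).
Let mK i : measurable (K i) := open_rV_measurable (@oK i).
Implicit Types (v w : U -> R).

Definition L2b : set (U -> R) := [set v | forall i, L2 (K i) v].
Definition H1b : set (U -> R) := [set v | forall i, H1 (K i) v].
Definition mass v w : R := \sum_i inner (K i) v w.
Definition stiff v w : R := \sum_i dirichlet (K i) v w.
(** The coefficients [alpha], [beta] give the discrete bilinear form and [1], [1] the square of the
    broken norm, so one Cauchy-Schwarz argument serves both. *)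
Definition energy (a b : R) v w : R := a * stiff v w + b * mass v w.

Lemma H1b_L2b : H1b `<=` L2b.
Proof. by move=> v Hv i; case: (Hv i). Qed.

Lemma semi_inner_mass : semi_inner L2b mass.
Proof.
apply: (@semi_inner_sum _ _ _ (fun i => L2 (K i)) (fun i => inner (K i))) => i; split.
- by move=> a v w; exact: L2_lin.
- by move=> v w; exact: innerC.
- by move=> v; exact: inner_ge0.
- by move=> a v w z; exact: inner_linl.
Qed.

Lemma semi_inner_stiff : semi_inner H1b stiff.
Proof.
apply: (@semi_inner_sum _ _ _ (fun i => H1 (K i)) (fun i => dirichlet (K i))) => i; split.
- by move=> a v w; exact: H1_lin.
- by move=> v w; exact: inner_vecC.
- by move=> v; exact: inner_vec_ge0.
- by move=> a v w z; exact: dirichlet_linl.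
Qed.

Lemma semi_inner_energy (a b : R) : 0 <= a -> 0 <= b -> semi_inner H1b (energy a b).
Proof.
move=> a0 b0; have [cH _ _ _] := semi_inner_stiff.
have [_ ms m0 ml] := semi_inner_mass.
have sm : semi_inner H1b mass.
  split; [exact: cH|exact: ms|exact: m0|].
  by move=> c v w z /H1b_L2b Lv /H1b_L2b Lw /H1b_L2b Lz; exact: ml.
exact: (semi_inner_comb a0 b0 semi_inner_stiff sm).
Qed.

Lemma broken_normE v : broken_norm K v = Num.sqrt (energy 1 1 v v).
Proof.
congr Num.sqrt; rewrite /energy !mul1r -big_split; apply: eq_bigr => i _ /=.
rewrite /normH1 sqr_sqrtr ?addr_ge0 ?sqr_ge0// addrC /normL2 /seminormH1.
by rewrite !sqr_sqrtr// ?inner_ge0// inner_vec_ge0.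
Qed.

Lemma broken_norm_ge0 v : 0 <= broken_norm K v.
Proof. exact: sqrtr_ge0. Qed.

Lemma stiff_ge0 v : 0 <= stiff v v.
Proof. by have [] := semi_inner_stiff. Qed.

Lemma mass_ge0 v : 0 <= mass v v.
Proof. by have [] := semi_inner_mass. Qed.

Lemma sqr_broken_norm v : broken_norm K v ^+ 2 = stiff v v + mass v v.
Proof.
by rewrite broken_normE sqr_sqrtr /energy !mul1r// addr_ge0 ?stiff_ge0 ?mass_ge0.
Qed.

Lemma broken_norm_lin (a : R) v w : H1b v -> H1b w ->
  broken_norm K (fun x => a * v x + w x) <= `|a| * broken_norm K v + broken_norm K w.
Proof.
move=> Hv Hw; rewrite !broken_normE.
by apply: (@semi_norm_lin _ _ H1b) => //; exact: semi_inner_energy.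
Qed.

(** Cauchy-Schwarz for the energy itself, after which both coefficients are bounded by [a + b]. *)
Lemma energy_le (a b : R) v w : 0 <= a -> 0 <= b -> H1b v -> H1b w ->
  `|energy a b v w| <= (a + b) * broken_norm K v * broken_norm K w.
Proof.
move=> a0 b0 Hv Hw.
have E z : energy a b z z <= (a + b) * broken_norm K z ^+ 2.
  rewrite sqr_broken_norm /energy.
  by have := stiff_ge0 z; have := mass_ge0 z; nra.
apply: le_trans (cauchy_schwarz (semi_inner_energy a0 b0) Hv Hw) _.
have ab : 0 <= a + b by rewrite addr_ge0.
have S z : Num.sqrt (energy a b z z) <= Num.sqrt (a + b) * broken_norm K z.
  rewrite -[broken_norm K z]ger0_norm ?broken_norm_ge0// -sqrtr_sqr -sqrtrM//.
  exact: ler_wsqrtr.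
apply: le_trans (ler_pM (sqrtr_ge0 _) (sqrtr_ge0 _) (S v) (S w)) _.
by rewrite mulrACA -expr2 sqr_sqrtr// mulrA.
Qed.

Lemma energy_coercive (a b : R) v :
  Num.min a b * broken_norm K v ^+ 2 <= energy a b v v.
Proof.
rewrite sqr_broken_norm /energy mulrDr lerD// ler_wpM2r ?stiff_ge0 ?mass_ge0//.
  by rewrite ge_min lexx.
by rewrite ge_min lexx orbT.
Qed.

Lemma mass_le v w : L2b v -> H1b w ->
  `|mass v w| <= Num.sqrt (mass v v) * broken_norm K w.
Proof.
move=> Lv Hw.
apply: le_trans (cauchy_schwarz semi_inner_mass Lv (H1b_L2b Hw)) _.
rewrite ler_wpM2l ?sqrtr_ge0// broken_normE ler_wsqrtr// /energy !mul1r.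
by rewrite lerDr stiff_ge0.
Qed.

Lemma energy_extl (a b : R) v v' w : (forall i x, K i x -> v x = v' x) ->
  energy a b v w = energy a b v' w.
Proof.
move=> vv.
have sE : stiff v w = stiff v' w.
  by apply: eq_bigr => i _; rewrite /dirichlet (wgrad_ext (vv i)).
have mE : mass v w = mass v' w.
  by apply: eq_bigr => i _; exact: (inner_ext (vv i) (fun _ _ => erefl)).
by rewrite /energy sE mE.
Qed.

(** Read contrapositively: a function of nonzero broken norm is admissible in the supremum defining
    the consistency error. *)
Lemma broken_norm_aeq0 (D : set U) v : (forall i, K i `<=` D) -> H1b v ->
  ae_eq mu D v (cst 0) -> broken_norm K v = 0.
Proof.
move=> KD Hv v0; rewrite broken_normE /energy /stiff /mass.
have E i : inner (K i) v v = 0 /\ dirichlet (K i) v v = 0.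
  have [_ ? ?] := aeq0_forms (@oK i) (@fK i) (Hv i).1
    (filterS (fun x H Kx => H (KD i x Kx)) v0).
  by split.
by rewrite !big1 ?mulr0 ?addr0 ?sqrtr0// => i _; have [] := E i.
Qed.

Hypothesis tK : trivIset setT K.

Lemma glueE (h : I -> U -> R) i x : K i x -> Defs.glue K h x = h i x.
Proof.
move=> Kx; rewrite /Defs.glue (bigD1 i)//= /restr0 patchE mem_set// big1 ?addr0// => j ji.
rewrite patchE memNset// => Kjx; move/eqP: ji; apply.
by apply: tK => //; exists x.
Qed.

Lemma glue_out (h : I -> U -> R) x : (forall i, ~ K i x) -> Defs.glue K h x = 0.
Proof. by move=> nK; rewrite /Defs.glue big1// => i _; rewrite /restr0 patchE memNset. Qed.

Lemma inner_vec_integrable D (F G : U -> U) : measurable D -> L2_vec D F -> L2_vec D G ->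
  mu.-integrable D (EFin \o (fun x => \sum_i F x ord0 i * G x ord0 i)).
Proof.
move=> mD LF LG.
pose h i x := (F x ord0 i * G x ord0 i)%:E.
have ih : mu.-integrable D (fun x => (\sum_i h i x)%E).
  by apply: integrable_sum => // i _; exact: L2_mul_integrable (LF i) (LG i).
by apply: (eq_integrable mD _ _ _ ih) => x _; rewrite /= /h sumEFin.
Qed.

Lemma broken_grad_row v i x : K i x -> broken_grad K v x = wgrad (K i) v x.
Proof. by move=> Kx; apply/rowP => j; rewrite mxE (glueE _ Kx). Qed.

Lemma discrete_energy (D : set U) (alpha beta : R) v w : measurable D ->
  (forall i, K i `<=` D) -> H1b v -> H1b w -> (forall x, (forall i, ~ K i x) -> w x = 0) ->
  inner_vec D (fun x => alpha *: broken_grad K v x) (broken_grad K w) +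
  inner D (fun x => beta * v x) w = energy alpha beta v w.
Proof.
move=> mD KD Hv Hw w0.
have Sv i : L2_vec (K i) (fun x => alpha *: wgrad (K i) v x).
  move=> j; rewrite (_ : (fun _ => _) = fun x => alpha * wgrad (K i) v x ord0 j).
    by apply: L2_scale => //; exact: (L2_wgrad (Hv i)).
  by apply/funext => x; rewrite mxE.
rewrite /energy /stiff /mass !mulr_sumr; congr (_ + _).
  rewrite /inner_vec (Rintegral_cells mD mK KD tK).
  - apply: eq_bigr => i _; rewrite /dirichlet -inner_vec_scalel//; [|exact: L2_wgrad..].
    by apply: eq_Rintegral => x /set_mem Kx; rewrite !(broken_grad_row _ Kx).
  - move=> i; have := inner_vec_integrable (mK i) (Sv i) (L2_wgrad (Hw i)).
    by apply: (eq_integrable (mK i)) => x /set_mem Kx; rewrite /= !(broken_grad_row _ Kx).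
  - move=> x nx; rewrite big1// => j _.
    by rewrite [broken_grad K w x ord0 j]mxE glue_out// mulr0.
rewrite /inner (Rintegral_cells mD mK KD tK).
- apply: eq_bigr => i _; rewrite -/(inner (K i) (fun x => beta * v x) w) inner_scalel//.
    by case: (Hv i).
  by case: (Hw i).
- move=> i; apply: L2_mul_integrable => //; last by case: (Hw i).
  by apply: L2_scale => //; case: (Hv i).
- by move=> x nx; rewrite w0// mulr0.
Qed.

Lemma inner_mass (D : set U) f w : measurable D ->
  (forall i, K i `<=` D) -> L2 D f -> H1b w -> (forall x, (forall i, ~ K i x) -> w x = 0) ->
  inner D f w = mass f w.
Proof.
move=> mD KD Lf Hw w0; rewrite /inner (Rintegral_cells mD mK KD tK)//.
- move=> i; apply: L2_mul_integrable => //; last by case: (Hw i).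
  exact: L2_subset Lf.
- by move=> x nx; rewrite w0// mulr0.
Qed.

End broken_forms.

(** * The Strang estimate *)

Lemma sqr_sum_mono (R : realDomainType) (c p q r t a b : R) : 0 <= c ->
  0 <= p -> 0 <= r -> p <= c * q -> r <= c * t ->
  a = p ^+ 2 + r ^+ 2 -> b = q ^+ 2 + t ^+ 2 -> a <= c ^+ 2 * b.
Proof.
move=> c0 p0 r0 pq rt -> ->; rewrite mulrDr -!exprMn.
by apply: lerD; rewrite lerXn2r ?nnegrE//; [exact: le_trans pq|exact: le_trans rt].
Qed.

Lemma ler_add_mul (R : realDomainType) (a b p q c x y : R) : 0 <= q -> 0 <= p ->
  a <= q * y -> b <= p * y -> y <= c * x -> a + b <= (q + p) * c * x.
Proof.
move=> q0 p0 aqy bpy yx; apply: le_trans (lerD aqy bpy) _.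
by rewrite -mulrDl -mulrA ler_wpM2l// addr_ge0.
Qed.

(* The case [n = 0] is covered since then [r / n = 0]. *)
Lemma ler_div_norm (R : realFieldType) (r n M : R) : 0 <= n -> 0 <= M ->
  `|r| <= M * n -> r / n <= M.
Proof.
rewrite le_eqVlt => /predU1P[<-|n0] M0 rM; first by rewrite invr0 mulr0.
by rewrite ler_pdivrMr// (le_trans (ler_norm r)).
Qed.

Lemma ler_norm_div (R : realFieldType) (r n g : R) : 0 < n ->
  r / n <= g -> - (r / n) <= g -> `|r| <= g * n.
Proof.
move=> n0; rewrite -mulNr !ler_pdivrMr// => rg Nrg.
by rewrite ler_norml lerNl Nrg.
Qed.

(** Evenness of the broken norm, from the triangle inequality for [v |-> -v] and back; [c] stands
    for the norm of the zero function. *)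
Lemma eq_normN (R : realDomainType) (a b c : R) : c = 0 ->
  a <= `|-1| * b + c -> b <= `|-1| * a + c -> a = b.
Proof.
move=> ->; rewrite normrN1 !mul1r !addr0 => ab ba.
by apply/eqP; rewrite eq_le ab.
Qed.

(** Dictionary, with [e = uh - ui] and [d = upi - ui]: [Ne], [Nd], [Np] are the norms of [e], [d],
    [u - upi], and [NJe], [NJd] those of [Jh e], [Jh d]; [fl] is the flux of [e] and [m] is
    [(f, Jh e)]. The numbers [aee], [ai], [ah], [ad], [ap], [api], [au], [Jpi] are the energies
    against [Jh e] of [Jh e], [Jh ui], [Jh uh], [Jh d], [u - upi], [upi], [u], [Jh upi]. *)
Lemma strang_arith (R : realFieldType)
    (alpha beta c1 c2 G Ne Nd Np fl m aee ai ah ad ap api au Jpi NJe NJd : R) :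
  0 < alpha -> 0 < beta -> 0 < c1 -> 0 < c2 -> 0 <= G ->
  0 <= Ne -> 0 <= Nd -> 0 <= Np ->
  fl = au - m -> ah = m -> aee = -1 * ai + ah -> ad = -1 * ai + Jpi ->
  ap = -1 * api + au -> api = Jpi ->
  `|ad| <= (alpha + beta) * NJd * NJe -> `|ap| <= (alpha + beta) * Np * NJe ->
  Num.min alpha beta * NJe ^+ 2 <= aee -> c1 * Ne <= NJe -> NJe <= c2 * Ne ->
  NJd <= c2 * Nd -> `|fl| <= G * Ne ->
  Num.min alpha beta * c1 ^+ 2 * Ne <=
    (alpha + beta) * (c2 ^+ 2 * Nd + c2 * Np) + G.
Proof.
move=> a0 b0 c10 c20 G0 Ne0 Nd0 Np0 flE ahE aeeE adE apE apiE had hap co J1 J2 J3 hfl.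
have ab : 0 < alpha + beta by rewrite addr_gt0.
have m0 : 0 < Num.min alpha beta by rewrite lt_min a0.
have aeeE' : aee = ad + ap - fl by rewrite aeeE adE apE apiE flE ahE; ring.
(* All bounds are multiples of [Ne], which is cancelled below and so must be nonzero. *)
have [->|Ne1] := eqVneq Ne 0.
  by rewrite mulr0 addr_ge0// mulr_ge0 ?addr_ge0 ?mulr_ge0 ?sqr_ge0// ltW.
have Nep : 0 < Ne by rewrite lt_neqAle eq_sym Ne1.
rewrite -(ler_pM2r Nep).
have NJe0 : 0 <= NJe by apply: le_trans J1; rewrite mulr_ge0// ltW.
have s1 : Num.min alpha beta * c1 ^+ 2 * Ne * Ne <= aee.
  apply: le_trans co.
  rewrite (_ : _ * Ne = Num.min alpha beta * (c1 * Ne) ^+ 2); last by ring.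
  by rewrite ler_pM2l// lerXn2r ?nnegrE// mulr_ge0// ltW.
have s2 : ad <= (alpha + beta) * (c2 * Nd) * (c2 * Ne).
  apply: le_trans (ler_norm _) _; apply: le_trans had _.
  rewrite -!mulrA ler_pM2l// mulrA.
  apply: (@le_trans _ _ (c2 * Nd * NJe)); first by rewrite ler_wpM2r.
  by rewrite -!mulrA !ler_wpM2l ?(ltW c20).
have s3 : ap <= (alpha + beta) * Np * (c2 * Ne).
  apply: le_trans (ler_norm _) _; apply: le_trans hap _.
  by rewrite ler_wpM2l// mulr_ge0// ltW.
have s4 : - fl <= G * Ne by apply: le_trans hfl; rewrite -normrN ler_norm.
apply: le_trans s1 _; rewrite aeeE'.
rewrite (_ : _ * Ne = (alpha + beta) * (c2 * Nd) * (c2 * Ne) +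
  (alpha + beta) * Np * (c2 * Ne) + G * Ne); last by ring.
by rewrite !lerD.
Qed.

(** Both [Nd] and [Np] are at most [Ni + Np], giving [(alpha + beta) * (c2 ^+ 2 + c2)]; the inner 1
    absorbs [G], and the outer 1 absorbs [Ni] from the triangle inequality through the
    interpolant. *)
Lemma final_arith (R : realFieldType) (alpha beta c1 c2 G N Ne Nd Np Ni Np' : R) :
  0 < alpha -> 0 < beta -> 0 < c1 -> 0 < c2 -> 0 <= G -> 0 <= Ni -> 0 <= Np ->
  N <= `|-1| * Ne + Ni -> Nd <= `|-1| * Np + Ni -> Np' = Np ->
  Num.min alpha beta * c1 ^+ 2 * Ne <=
    (alpha + beta) * (c2 ^+ 2 * Nd + c2 * Np') + G ->
  N <= (1 + ((alpha + beta) * (c2 ^+ 2 + c2) + 1) /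
    (Num.min alpha beta * c1 ^+ 2)) * (Ni + Np + G).
Proof.
rewrite normrN1 !mul1r => a0 b0 c10 c20 G0 Ni0 Np0 hN hNd -> est.
have ab : 0 < alpha + beta by rewrite addr_gt0.
have m0 : 0 < Num.min alpha beta * c1 ^+ 2.
  by rewrite mulr_gt0 ?exprn_gt0// lt_min a0.
have hNe : Ne <= ((alpha + beta) * (c2 ^+ 2 + c2) + 1) /
    (Num.min alpha beta * c1 ^+ 2) * (Ni + Np + G).
  rewrite mulrAC ler_pdivlMr// [leLHS]mulrC; apply: le_trans est _.
  rewrite [leRHS]mulrDl mul1r lerD//; last by rewrite lerDr addr_ge0.
  rewrite -[leRHS]mulrA ler_pM2l// [leRHS]mulrDl lerD//.
    by rewrite ler_pM2l ?exprn_gt0//; apply: le_trans hNd _; lra.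
  rewrite ler_pM2l//; lra.
apply: le_trans hN _; rewrite mulrDl mul1r addrC lerD//; lra.
Qed.

(** * The operator [Jh] on cellwise virtual element functions *)

Section interpolation.
Context {R : realType} {d : nat} {I : finType} (K : I -> set 'rV[R]_d).
Local Notation U := 'rV[R]_d.
Local Notation mu := (rV_lebesgue R d).
Hypotheses (oK : forall i, open (K i)) (fK : forall i, (mu (K i) < +oo)%E).
Hypothesis tK : trivIset setT K.
Let mK i : measurable (K i) := open_rV_measurable (@oK i).
Variables (k : nat) (c1 c2 : R) (T : I -> seq 'M[R]_(d.+1, d)).
Variables (V W : I -> set (U -> R)) (J : I -> (U -> R) -> (U -> R)).
Hypotheses (c10 : 0 < c1) (c20 : 0 < c2).
Hypothesis vemV : forall i, local_vem_space k (K i) (V i).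
Hypothesis macroW : forall i, macro_space (K i) (T i) (W i).
Hypothesis macroJ : forall i, macro_interpolation k c1 c2 (K i) (V i) (W i) (J i).
Implicit Types (v w : U -> R).

(** A common space for [Vh] and the piecewise polynomials, so that [upi - ui] lies in the domain of
    [Jh]. *)
Definition broken_vem : set (U -> R) := [set v | forall i, V i (restr0 (K i) v)].
Local Notation Jh := (global_interp K J).

Lemma restr0E i v x : K i x -> restr0 (K i) v x = v x.
Proof. by move=> Kx; rewrite /restr0 patchE mem_set. Qed.

Lemma restr0_lin i (a : R) v w : restr0 (K i) (fun x => a * v x + w x) =
  (fun x => a * restr0 (K i) v x + restr0 (K i) w x).
Proof.
by apply/funext => x; rewrite /restr0 !patchE; case: ifP => //; rewrite mulr0 addr0.
Qed.

Lemma broken_vem_lin : lin_closed broken_vem.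
Proof.
move=> a v w Vv Vw i; rewrite restr0_lin.
by have [_ _ [_ cV] _ _] := vemV i; exact: cV.
Qed.

Lemma broken_vem_H1b : broken_vem `<=` H1b K.
Proof.
move=> v Vv i; have [_ VH _ _ _] := vemV i.
by apply: H1_ext (VH _ (Vv i)) => // x /restr0E.
Qed.

Lemma broken_poly_vem v : (forall i, Pk k (K i) (restr0 (K i) v)) -> broken_vem v.
Proof. by move=> Pv i; have [_ _ _ _ PV] := vemV i; exact/PV/Pv. Qed.

Lemma global_interpE i v x : K i x -> Jh v x = J i (restr0 (K i) v) x.
Proof. by move=> Kx; rewrite /global_interp (glueE tK _ Kx). Qed.

Lemma global_interp_H1b v : broken_vem v -> H1b K (Jh v).
Proof.
move=> Vv i; have [_ WH _ _] := macroW i; have [JW _ _ _] := macroJ i.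
apply: H1_ext (WH _ (JW _ (Vv i))) => // x Kx; exact/esym/global_interpE.
Qed.

Lemma global_interp_out v x : (forall i, ~ K i x) -> Jh v x = 0.
Proof. exact: glue_out. Qed.

Lemma global_interp_lin (a : R) v w : broken_vem v -> broken_vem w ->
  Jh (fun x => a * v x + w x) = (fun x => a * Jh v x + Jh w x).
Proof.
move=> Vv Vw; apply/funext => x.
have [[i Kx]|nK] := pselect (exists i, K i x).
  rewrite !(global_interpE _ Kx) restr0_lin.
  by have [_ Jl _ _] := macroJ i; rewrite Jl.
have {}nK i : ~ K i x by move=> Kx; apply: nK; exists i.
by rewrite !global_interp_out// mulr0 addr0.
Qed.

Lemma global_interp_poly v i x : (forall i, Pk k (K i) (restr0 (K i) v)) ->
  K i x -> v x = Jh v x.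
Proof.
move=> Pv Kx; rewrite (global_interpE _ Kx); have [_ _ Jp _] := macroJ i.
by rewrite Jp ?restr0E//; exact: Pv.
Qed.

Lemma broken_norm_mono (c : R) v w : 0 <= c ->
  (forall i, normL2 (K i) v <= c * normL2 (K i) w) ->
  (forall i, seminormH1 (K i) v <= c * seminormH1 (K i) w) ->
  broken_norm K v <= c * broken_norm K w.
Proof.
move=> c0 l s; rewrite -(ger0_norm c0) -sqrtr_sqr -sqrtrM ?sqr_ge0// ler_wsqrtr//.
rewrite mulr_sumr; apply: ler_sum => i _.
have E z : normH1 (K i) z ^+ 2 = normL2 (K i) z ^+ 2 + seminormH1 (K i) z ^+ 2.
  by apply: sqr_sqrtr; rewrite addr_ge0 ?sqr_ge0.
have [lv sv] := (sqrtr_ge0 _ : 0 <= normL2 (K i) v, sqrtr_ge0 _ : 0 <= seminormH1 (K i) v).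
exact: (sqr_sum_mono c0 lv sv (l i) (s i) (E v) (E w)).
Qed.

Lemma normL2_ext (D : set U) v w : (forall x, D x -> v x = w x) ->
  normL2 D v = normL2 D w.
Proof. by move=> vw; rewrite /normL2 (inner_ext vw vw). Qed.

Lemma seminormH1_ext (D : set U) v w : (forall x, D x -> v x = w x) ->
  seminormH1 D v = seminormH1 D w.
Proof. by move=> vw; rewrite /seminormH1 (wgrad_ext vw). Qed.

Lemma global_interp_norm v : broken_vem v ->
  c1 * broken_norm K v <= broken_norm K (Jh v) <= c2 * broken_norm K v.
Proof.
move=> Vv.
have JE i := normL2_ext (fun x => @global_interpE i v x).
have JE' i := seminormH1_ext (fun x => @global_interpE i v x).
have rE i := normL2_ext (fun x => @restr0E i v x).
have rE' i := seminormH1_ext (fun x => @restr0E i v x).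
have H i : [/\ c1 * normL2 (K i) v <= normL2 (K i) (Jh v),
    normL2 (K i) (Jh v) <= c2 * normL2 (K i) v,
    c1 * seminormH1 (K i) v <= seminormH1 (K i) (Jh v) &
    seminormH1 (K i) (Jh v) <= c2 * seminormH1 (K i) v].
  have [_ _ _ Jn] := macroJ i; have [/andP[? ?] /andP[? ?]] := Jn _ (Vv i).
  by rewrite JE JE' -rE -rE'; split.
apply/andP; split; last first.
  by apply: broken_norm_mono (ltW c20) _ _ => i; have [] := H i.
(* The lower bound is the monotonicity lemma with the roles exchanged and factor [c1^-1]. *)
rewrite -ler_pdivlMl//; apply: broken_norm_mono; first by rewrite invr_ge0 ltW.
  by move=> i; rewrite ler_pdivlMl//; have [] := H i.
by move=> i; rewrite ler_pdivlMl//; have [] := H i.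
Qed.

(** * Boundary flux and consistency error *)

Variables (Omega : set U) (alpha beta : R) (f u : U -> R) (Vh : set (U -> R)).
Hypotheses (oO : open Omega) (fO : (mu Omega < +oo)%E) (KO : forall i, K i `<=` Omega).
Hypotheses (a0 : 0 < alpha) (b0 : 0 < beta) (Lf : L2 Omega f).
Hypothesis wu : weak_solution Omega alpha beta f u.
Hypothesis subV : Defs.subspace Vh.
Hypothesis VhV : Vh `<=` broken_vem.
Let mO : measurable Omega := open_rV_measurable oO.
Local Notation a_h := (energy K alpha beta).
Local Notation G := (consistency_error K Omega alpha u Vh Jh).

Definition flux v : R := \sum_i normal_flux (K i) alpha u (Jh v).

Lemma weak_solution_H1b : H1b K u.
Proof. by move=> i; have [[Hu _] _] := wu; exact: (H1_subset mO (mK i) (@KO i) Hu). Qed.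

Lemma source_L2b : L2b K f.
Proof. by move=> i; exact: (L2_subset mO (mK i) (@KO i) Lf). Qed.

(** The flux is the residual of [u] in the discrete equation. Its linearity and boundedness are read
    off this formula. *)
Lemma fluxE v : broken_vem v -> flux v = a_h u (Jh v) - mass K f (Jh v).
Proof.
move=> Vv.
have nf i := normal_flux_weak_solution oO fO (@oK i) (@KO i) a0 Lf wu
  (global_interp_H1b Vv i).
by rewrite /flux (eq_bigr _ (fun i _ => nf i)) sumrB big_split /= -!mulr_sumr.
Qed.

Lemma flux_lin (a : R) v w : broken_vem v -> broken_vem w ->
  flux (fun x => a * v x + w x) = a * flux v + flux w.
Proof.
move=> Vv Vw; have [Hv Hw] := (global_interp_H1b Vv, global_interp_H1b Vw).
have Hu := weak_solution_H1b; have Lf' := source_L2b.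
rewrite !fluxE//; last exact: broken_vem_lin.
rewrite global_interp_lin//.
have [_ es _ el] := semi_inner_energy oK fK (ltW a0) (ltW b0).
have [_ ms _ ml] := semi_inner_mass oK.
rewrite (es u) (ms f) el// ml//; [|exact: H1b_L2b..].
by rewrite (es _ u) (es _ u) (ms _ f) (ms _ f); ring.
Qed.

Lemma fluxN v : broken_vem v -> flux (fun x => -1 * v x + 0) = - flux v.
Proof.
move=> Vv; have V0 : broken_vem (fun=> 0).
  have := broken_vem_lin (-1) Vv Vv.
  by rewrite (_ : (fun _ => _) = (fun=> 0))//; apply/funext => x; rewrite mulN1r addNr.
(* Gives [flux 0 = flux 0 + flux 0], hence [flux 0 = 0]. *)
have := flux_lin 1 V0 V0.
rewrite (_ : (fun _ => 1 * 0 + 0) = (fun=> 0)); last first.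
  by apply/funext => x; rewrite mulr0 addr0.
have := flux_lin (-1) Vv V0; lra.
Qed.

(** Makes the set of quotients bounded above, and the flux zero on functions of zero broken norm. *)
Lemma flux_bounded : exists2 M : R, 0 <= M &
  forall v, broken_vem v -> `|flux v| <= M * broken_norm K v.
Proof.
have Hu := weak_solution_H1b.
have q0 : 0 <= (alpha + beta) * broken_norm K u.
  exact: mulr_ge0 (addr_ge0 (ltW a0) (ltW b0)) (broken_norm_ge0 K u).
have p0 : 0 <= Num.sqrt (mass K f f) by exact: sqrtr_ge0.
exists (((alpha + beta) * broken_norm K u + Num.sqrt (mass K f f)) * c2).
  exact: mulr_ge0 (addr_ge0 q0 p0) (ltW c20).
move=> v Vv; rewrite (fluxE Vv); have HJ := global_interp_H1b Vv.
apply: le_trans (ler_normB _ _) _.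
have h2 := energy_le oK fK (ltW a0) (ltW b0) Hu HJ.
have h1 := mass_le oK fK source_L2b HJ.
have /andP[_ Jn] := global_interp_norm Vv.
exact: ler_add_mul q0 p0 h2 h1 Jn.
Qed.

Let S : set R := [set r | exists vh, [/\ Vh vh,
    ~ ae_eq mu Omega vh (cst 0)
    & r = (\sum_i normal_flux (K i) alpha u (Jh vh)) / broken_norm K vh]].

Lemma consistency_set_ubound : has_ubound S.
Proof.
have [M M0 fM] := flux_bounded; exists M => _ [v [/VhV Vv _ ->]].
exact: ler_div_norm (broken_norm_ge0 K v) M0 (fM v Vv).
Qed.

(** The flux is odd and the broken norm even. Hence the supremum is nonnegative and bounds the
    quotients in absolute value. *)
Lemma consistency_setN r : S r -> S (- r).
Proof.
move=> [v [Vv nv ->]]; have [V0 lV] := subV.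
rewrite /S /=; exists (fun x => -1 * v x + 0); split; first exact: lV.
  by move=> v0; apply: nv; apply: filterS v0 => x H Dx; have /= := H Dx; lra.
have H0 : H1b K (fun=> 0) by apply: broken_vem_H1b; exact: VhV.
have Hv : H1b K v by apply: broken_vem_H1b; exact: VhV.
have n0 : broken_norm K (fun=> 0) = 0.
  by apply: (broken_norm_aeq0 oK fK KO H0); exact: aeW.
have Hw : H1b K (fun x => -1 * v x + 0).
  by apply: broken_vem_H1b; apply: VhV; exact: lV.
have le1 := broken_norm_lin oK fK (-1) Hv H0.
have le2 := broken_norm_lin oK fK (-1) Hw H0.
have vE : (fun x => -1 * (-1 * v x + 0) + 0) = v.
  by apply/funext => x; rewrite !addr0 !mulN1r opprK.
rewrite vE in le2; have nE := eq_normN n0 le1 le2.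
rewrite nE -mulNr; congr (_ / _); exact: (esym (fluxN (VhV Vv))).
Qed.

Lemma consistency_error_ge0 : 0 <= G.
Proof.
rewrite -[G]/(sup S); have [S0|/nonemptyPn S0] := pselect (S !=set0); last first.
  by rewrite S0 sup0.
have [r Sr] := S0.
have := ub_le_sup consistency_set_ubound Sr.
have := ub_le_sup consistency_set_ubound (consistency_setN Sr); lra.
Qed.

Lemma flux_le_consistency v : Vh v -> `|flux v| <= G * broken_norm K v.
Proof.
move=> Vv; have [M M0 fM] := flux_bounded.
have := broken_norm_ge0 K v; rewrite le_eqVlt => /predU1P[n0|n0].
  by have := fM _ (VhV Vv); rewrite -n0 !mulr0.
have Sv : S (flux v / broken_norm K v).
  rewrite /S /=; exists v; split; [exact: Vv| |by []] => v0; move: n0.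
  rewrite (broken_norm_aeq0 oK fK KO _ v0) ?ltxx//.
  by apply: broken_vem_H1b; exact: VhV.
have le1 := ub_le_sup consistency_set_ubound Sv.
have le2 := ub_le_sup consistency_set_ubound (consistency_setN Sv).
exact: ler_norm_div n0 le1 le2.
Qed.

Lemma strang_estimate uh upi ui :
  Vh uh -> Vh ui -> (forall i, Pk k (K i) (restr0 (K i) upi)) ->
  discrete_solution K Omega alpha beta f Vh Jh uh ->
  Num.min alpha beta * c1 ^+ 2 * broken_norm K (fun x => -1 * ui x + uh x) <=
  (alpha + beta) * (c2 ^+ 2 * broken_norm K (fun x => -1 * ui x + upi x) +
    c2 * broken_norm K (fun x => -1 * upi x + u x)) + G.
Proof.
move=> Vuh Vui Ppi [_ duh]; set e := (fun x => -1 * ui x + uh x).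
set de := (fun x => -1 * ui x + upi x); set pe := (fun x => -1 * upi x + u x).
have Ve : Vh e by have [_ lV] := subV; exact: lV.
have [Be Buh Bui] := And3 (VhV Ve) (VhV Vuh) (VhV Vui).
have Bpi := broken_poly_vem Ppi.
have Bde : broken_vem de by exact: broken_vem_lin.
have HJe := global_interp_H1b Be; have HJuh := global_interp_H1b Buh.
have HJui := global_interp_H1b Bui.
have HJpi := global_interp_H1b Bpi; have HJde := global_interp_H1b Bde.
have Hpi := broken_vem_H1b Bpi; have Hu := weak_solution_H1b.
have sa := semi_inner_energy oK fK (ltW a0) (ltW b0).
have [cl es _ el] := sa.
have Hpe : H1b K pe by exact: cl.
have out := @global_interp_out.
have D1 : a_h (Jh uh) (Jh e) = mass K f (Jh e) := etrans
  (esym (discrete_energy oK tK alpha beta mO KO HJuh HJe (fun x => out e x)))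
  (etrans (duh e Ve) (inner_mass oK tK mO KO Lf HJe (fun x => out e x))).
have lin v w (vw : v = w) := congr1 (fun w => a_h w (Jh e)) vw.
have L1 : a_h (Jh e) (Jh e) = -1 * a_h (Jh ui) (Jh e) + a_h (Jh uh) (Jh e) :=
  etrans (lin _ _ (global_interp_lin (-1) Bui Buh)) (el _ _ _ _ HJui HJuh HJe).
have L2 : a_h (Jh de) (Jh e) = -1 * a_h (Jh ui) (Jh e) + a_h (Jh upi) (Jh e) :=
  etrans (lin _ _ (global_interp_lin (-1) Bui Bpi)) (el _ _ _ _ HJui HJpi HJe).
have L3 : a_h pe (Jh e) = -1 * a_h upi (Jh e) + a_h u (Jh e) :=
  el _ _ _ _ Hpi Hu HJe.
(* Polynomial preservation holds on the cells, and the energy sees nothing else. *)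
have L4 : a_h upi (Jh e) = a_h (Jh upi) (Jh e).
  by apply: energy_extl => i x Kx; exact: global_interp_poly Kx.
have E1 := energy_le oK fK (ltW a0) (ltW b0) HJde HJe.
have E2 := energy_le oK fK (ltW a0) (ltW b0) Hpe HJe.
have co := energy_coercive oK fK alpha beta (Jh e).
have /andP[J1 J2] := global_interp_norm Be.
have /andP[_ J3] := global_interp_norm Bde.
have P := strang_arith a0 b0 c10 c20 consistency_error_ge0
  (broken_norm_ge0 K e) (broken_norm_ge0 K de) (broken_norm_ge0 K pe)
  (fluxE Be) D1 L1 L2 L3 L4 E1 E2.
have {}P := P co J1 J2 J3.
exact: P (flux_le_consistency Ve).
Qed.

Lemma strang_bound uh upi ui :
  Vh uh -> Vh ui -> (forall i, Pk k (K i) (restr0 (K i) upi)) ->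
  discrete_solution K Omega alpha beta f Vh Jh uh ->
  broken_norm K (fun x => u x - uh x) <=
    (1 + ((alpha + beta) * (c2 ^+ 2 + c2) + 1) / (Num.min alpha beta * c1 ^+ 2)) *
    (broken_norm K (fun x => u x - ui x) + broken_norm K (fun x => u x - upi x) + G).
Proof.
move=> Vuh Vui Ppi duh.
have est := strang_estimate Vuh Vui Ppi duh.
have [Huh Hui] := (broken_vem_H1b (VhV Vuh), broken_vem_H1b (VhV Vui)).
have Hpi := broken_vem_H1b (broken_poly_vem Ppi); have Hu := weak_solution_H1b.
have [cl _ _ _] := semi_inner_energy oK fK (ltW a0) (ltW b0).
have He : H1b K (fun x => -1 * ui x + uh x) by exact: cl.
have Hi : H1b K (fun x => u x - ui x).
  rewrite (_ : (fun _ => _) = (fun x => -1 * ui x + u x)); first exact: cl.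
  by apply/funext => x; rewrite mulN1r addrC.
have Hp : H1b K (fun x => u x - upi x).
  rewrite (_ : (fun _ => _) = (fun x => -1 * upi x + u x)); first exact: cl.
  by apply/funext => x; rewrite mulN1r addrC.
(* Triangle inequalities for [u - uh = -(uh - ui) + (u - ui)] and
   [upi - ui = -(u - upi) + (u - ui)]. *)
have N1 := broken_norm_lin oK fK (-1) He Hi.
have N2 := broken_norm_lin oK fK (-1) Hp Hi.
have E1 : (fun x => -1 * (-1 * ui x + uh x) + (u x - ui x)) = (fun x => u x - uh x).
  by apply/funext => x; ring.
have E2 : (fun x => -1 * (u x - upi x) + (u x - ui x)) = (fun x => -1 * ui x + upi x).
  by apply/funext => x; ring.
have E3 : (fun x => u x - upi x) = (fun x => -1 * upi x + u x).
  by apply/funext => x; ring.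
have {}N1 := eq_ind _ (fun w => broken_norm K w <= _) N1 _ E1.
have {}N2 := eq_ind _ (fun w => broken_norm K w <= _) N2 _ E2.
have N3 : broken_norm K (fun x => -1 * upi x + u x) =
    broken_norm K (fun x => u x - upi x) :=
  congr1 (broken_norm K) (esym E3).
exact: (final_arith a0 b0 c10 c20 consistency_error_ge0 (broken_norm_ge0 K _)
  (broken_norm_ge0 K _) N1 N2 N3 est).
Qed.

End interpolation.

Unset Implicit Arguments.

Theorem theorem2p2 (R : realType) (alpha beta c1 c2 : R) :
  0 < alpha -> 0 < beta -> 0 < c1 -> 0 < c2 ->
  exists C : R, 0 < C /\
  forall (d : nat) (Omega : set 'rV[R]_d)
    (I : finType) (K : I -> set 'rV[R]_d) (k : nat)
    (T : I -> seq 'M[R]_(d.+1, d))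
    (V W : I -> set ('rV[R]_d -> R))
    (J : I -> ('rV[R]_d -> R) -> ('rV[R]_d -> R))
    (Vh : set ('rV[R]_d -> R))
    (Ih : ('rV[R]_d -> R) -> ('rV[R]_d -> R))
    (f u uh upi : 'rV[R]_d -> R),
  (d = 2 \/ d = 3)%N ->
  polytopal Omega ->
  is_mesh Omega K ->
  (1 <= k)%N ->
  (forall i, local_vem_space k (K i) (V i)) ->
  global_vem_space K V Vh ->
  (forall i, simplicial_subdivision (T i) (K i)) ->
  (forall i, macro_space (K i) (T i) (W i)) ->
  (forall i, macro_interpolation k c1 c2 (K i) (V i) (W i) (J i)) ->
  L2 Omega f ->
  weak_solution Omega alpha beta f u ->
  Vh (Ih u) ->
  discrete_solution K Omega alpha beta f Vh (global_interp K J) uh ->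
  (forall i, Pk k (K i) (restr0 (K i) upi)) ->
  broken_norm K (fun x => u x - uh x) <=
    C * (broken_norm K (fun x => u x - Ih u x) +
         broken_norm K (fun x => u x - upi x) +
         consistency_error K Omega alpha u Vh (global_interp K J)).
Proof.
move=> a0 b0 c10 c20.
exists (1 + ((alpha + beta) * (c2 ^+ 2 + c2) + 1) / (Num.min alpha beta * c1 ^+ 2)).
split.
  rewrite addr_gt0// divr_gt0// ?addr_gt0// ?mulr_gt0// ?addr_gt0// ?exprn_gt0//.
  by rewrite lt_min a0.
move=> d Omega I K k T V W J Vh Ih f u uh upi _ [[oO _ _ bO _] _] [pK KO tK _] _.
move=> vemV [subV VhV] _ macroW macroJ Lf wu Vui duh Ppi.
have oK i : open (K i) by have [[]] := pK i.
have fin (D : set 'rV[R]_d) : open D -> bounded_set D -> (rV_lebesgue R d D < +oo)%E.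
  by move=> oD; apply: bounded_rV_lebesgue_fin; exact: open_rV_measurable.
have fO := fin _ oO bO.
have fK i : (rV_lebesgue R d (K i) < +oo)%E.
  by apply: fin (oK i) _; have [[]] := pK i.
exact: (strang_bound oK fK tK c10 c20 vemV macroW macroJ oO fO KO a0 b0 Lf wu subV
  (fun v Vv i => VhV v i Vv) (duh.1) Vui Ppi duh).
Qed.
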